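(* The following statements are equivalent: (1) ${\rm UP}={\rm coUP}$. (2) ${\rm CLU\#P}$ is closed under increment (i.e., $f\in{\rm CLU\#P}$ implies $x\mapsto f(x)+1$ is in ${\rm CLU\#P}$). (3) ${\rm CLU\#P}$ is closed under addition of natural-number-valued ${\rm FP}_{\rm t}$ functions (i.e., $f\in{\rm CLU\#P}$ and $g\in{\rm FP}_{\rm t}$ with $g:\Sigma^*\to\mathbb{N}$ imply $f+g\in{\rm CLU\#P}$). (4) ${\rm CLU\#P}$ is closed under addition of natural-number-valued ${\rm UPSV_t}$ functions. (5) ${\rm CLU\#P}$ is closed under addition (i.e., $f,g\in{\rm CLU\#P}$ imply $f+g\in{\rm CLU\#P}$).
   Context: Alphabet $\Sigma=\{0,1\}$; NPTM = nondeterministic polynomial-time Turing machine. ${\rm UP}$ is the class of languages accepted by NPTMs having at most one accepting path on every input; ${\rm coUP}$ is the class of their complements. For a polynomial $p$, an NPTM $M$ is $p$-balanced if on every input $x$ its computation paths correspond exactly to the guess strings in $\{0,1\}^{p(|x|)}$; paths are identified with guess strings. $\mathrm{acc}_M(x)$ is the set of accepting paths, $\#\mathrm{acc}_M(x)$ its size. ${\rm FP}_{\rm t}$: total polynomial-time computable functions. For same-length strings, $a\prec_{\rm lex}b$ means $b$ is the immediate lexicographic successor of $a$; $\le_{\rm lex}$ is lexicographic order. ${\rm CLU\#P}$: total $f:\Sigma^*\to\mathbb{N}$ such that there exist a polynomial $p$, a $p$-balanced NPTM $M$, $b,t\in{\rm FP}_{\rm t}$ and a polynomial-time 3-argument predicate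 $\prec$ such that for every $x$ there is a bijection $h_x$ of $\Sigma^{p(|x|)}$ with: $|b(x)|=|t(x)|=p(|x|)$; $h_x(b(x))=0^{p(|x|)}$, $h_x(t(x))=1^{p(|x|)}$; for $y,z\in\{0,1\}^{p(|x|)}$, $\prec(x,y,z)$ iff $h_x(y)\prec_{\rm lex}h_x(z)$; if $f(x)\neq0$ there exist $\ell,u$ with $\mathrm{acc}_M(x)=\{w\in\{0,1\}^{p(|x|)}: h_x(\ell)\le_{\rm lex}h_x(w)\le_{\rm lex}h_x(u)\}$; $f(x)=\#\mathrm{acc}_M(x)$. ${\rm UPSV_p}$: partial functions $g$ for which there is an NPTM that on every input has at most one accepting path, has an accepting path exactly on the domain of $g$, and outputs $g(x)$ on that path. ${\rm UPSV_t}$: the total functions in ${\rm UPSV_p}$. A function is natural-number-valued if it maps $\Sigma^*$ to $\mathbb{N}$. *)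

(* Defs.v *)
From HB Require Import structures.
From mathcomp Require Import all_boot all_order all_algebra.
From mathcomp Require Import classical_sets functions.

Set Implicit Arguments.
Unset Strict Implicit.
Unset Printing Implicit Defensive.

Import Order.TTheory.
Local Open Scope classical_set_scope.

Notation string := (seq bool).

(** * Nondeterministic multitape Turing machines *)

Inductive direction := MoveL | Stay | MoveR.

(* [Halt b]: the machine stops, accepting iff [b]. [Step m]: a deterministic
   step. [Guess m0 m1]: a binary nondeterministic step; bit 0 of the guess
   string selects [m0] and bit 1 selects [m1]. *)
Inductive transition (A : Type) :=
  | Halt of bool
  | Step of A
  | Guess of A & A.
Arguments Halt {A}.

(* The tape alphabet of a machine with auxiliary symbols [aux] consists of the
   blank [None], the bits [Some (inl b)], and the symbols [Some (inr s)]. *)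
Definition symbol (aux : finType) := option (bool + aux)%type.

(* The move of a machine with [k] tapes: a new state and, for each tape, the
   symbol written and the direction of the head. *)
Definition action (Q aux : finType) (k : nat) : Type :=
  (Q * ('I_k -> symbol aux * direction))%type.

Record machine := Machine {
  state : finType;
  start : state;
  aux : finType;
  (* one less than the number of tapes *)
  extra_tapes : nat;
  delta : state -> {ffun 'I_extra_tapes.+1 -> symbol aux} ->
          transition (action state aux extra_tapes.+1)
}.

(* Two-way infinite tapes as zippers: the cells to the left of the head,
   nearest first, and the cells from the head rightwards. Cells outside
   the two sequences are blank. *)
Definition tape (aux : finType) : Type := (seq (symbol aux) * seq (symbol aux))%type.

Definition read_tape aux (t : tape aux) : symbol aux := head None t.2.

Definition write_tape aux (s : symbol aux) (t : tape aux) : tape aux :=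
  (t.1, s :: behead t.2).

Definition move_head aux (d : direction) (t : tape aux) : tape aux :=
  match d with
  | MoveL => (behead t.1, head None t.1 :: t.2)
  | Stay => t
  | MoveR => (read_tape t :: t.1, behead t.2)
  end.

Section Semantics.
Variable M : machine.

Definition config : Type := (state M * ('I_(extra_tapes M).+1 -> tape (aux M)))%type.

(* The [i]-th argument is written on the [i]-th tape, with the head on its
   first symbol; the other tapes are empty. *)
Definition init a (xs : a.-tuple string) : config :=
  (start M, fun i : 'I_(extra_tapes M).+1 =>
     ([::], [seq Some (inl b) | b <- nth [::] xs i])).

Definition current (c : config) : transition (action (state M) (aux M) (extra_tapes M).+1) :=
  delta c.1 [ffun i => read_tape (c.2 i)].

Definition apply_action (m : action (state M) (aux M) (extra_tapes M).+1) (c : config) : config :=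
  (m.1, fun i => move_head (m.2 i).2 (write_tape (m.2 i).1 (c.2 i))).

Fixpoint bit_prefix (s : seq (symbol (aux M))) : string :=
  if s is Some (inl b) :: s' then b :: bit_prefix s' else [::].

(* The output is the longest bit string starting at the head of tape 0. *)
Definition output (c : config) : string := bit_prefix (c.2 ord0).2.

(* Every computation path from [c] halts after at most [n] steps. *)
Fixpoint halts_within (n : nat) (c : config) : bool :=
  match current c, n with
  | Halt _, _ => true
  | Step m, n'.+1 => halts_within n' (apply_action m c)
  | Guess m0 m1, n'.+1 =>
      halts_within n' (apply_action m0 c) && halts_within n' (apply_action m1 c)
  | _, 0 => false
  end.

(* The verdict and the output of the computation path with guess string [w],
   if it halts after at most [n] steps having used exactly the guesses [w]. *)
Fixpoint run (n : nat) (w : string) (c : config) : option (bool * string) :=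
  match current c, w, n with
  | Halt b, [::], _ => Some (b, output c)
  | Step m, _, n'.+1 => run n' w (apply_action m c)
  | Guess m0 m1, b :: w', n'.+1 => run n' w' (apply_action (if b then m1 else m0) c)
  | _, _, _ => None
  end.

Definition deterministic : Prop :=
  forall q r, if delta (m := M) q r is Guess _ _ then False else True.

End Semantics.

Definition input_size a (xs : a.-tuple string) : nat := sumn (map size xs).

(* Nondeterministic polynomial-time machines with [a] arguments. *)
Record nptm (a : nat) := NPTM {
  nptm_machine :> machine;
  clock : {poly nat};
  clockP : forall xs : a.-tuple string,
    halts_within clock.[input_size xs]%R (init nptm_machine xs)
}.

Section Paths.
Variables (a : nat) (M : nptm a) (xs : a.-tuple string).

(* By [clockP] the bound on the number of steps excludes no path. *)
Definition outcome (w : string) : option (bool * string) :=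
  run (clock M).[input_size xs]%R w (init M xs).

(* [w] is (the guess string of) a computation path. *)
Definition is_path (w : string) : bool := isSome (outcome w).

Definition accepts (w : string) : bool := if outcome w is Some (b, _) then b else false.

Definition at_most_one_accepting : Prop :=
  forall w w', accepts w -> accepts w' -> w = w'.

End Paths.

(** * Complexity classes *)

Definition language := set string.

Definition UP : set language :=
  [set L | exists M : nptm 1,
    (forall x, at_most_one_accepting M [tuple x]) /\
    forall x, L x <-> exists w, accepts M [tuple x] w].

Definition coUP : set language := [set ~` L | L in UP].

Definition FPt : set (string -> string) :=
  [set f | exists M : nptm 1, deterministic M /\
    forall x, omap snd (outcome M [tuple x] [::]) = Some (f x)].

Definition polytime_predicate3 (r : string -> string -> string -> Prop) : Prop :=
  exists M : nptm 3, deterministic M /\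
    forall x y z, r x y z <-> accepts M [tuple x; y; z] [::].

(* A partial function is undefined where its value is [None]. *)
Definition UPSVp : set (string -> option string) :=
  [set g | exists M : nptm 1, forall x,
    [/\ at_most_one_accepting M [tuple x],
        (exists w, accepts M [tuple x] w) <-> g x <> None
      & forall w v, outcome M [tuple x] w = Some (true, v) -> g x = Some v]].

Definition UPSVt : set (string -> string) := [set g | UPSVp (fun x => Some (g x))].

(* The binary numeral of [n], most significant bit first and without leading
   zeros ([0] is written "0"). *)
Definition bin (n : nat) : string :=
  rev (mkseq (fun i => odd (n %/ 2 ^ i)) (trunc_log 2 n).+1).

Definition nat_FPt : set (string -> nat) := [set g | FPt (bin \o g)].

Definition nat_UPSVt : set (string -> nat) := [set g | UPSVt (bin \o g)].

(** * Counting in intervals of polynomial-time computable orders *)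

Definition words (n : nat) : set string := [set w | size w = n].

Definition lex_le (y z : string) : Prop := (y <= z :> seqlexi bool)%O.

Definition lex_lt (y z : string) : Prop := (y < z :> seqlexi bool)%O.

(* [z] is the immediate successor of [y] among the strings of its length. *)
Definition lex_succ (y z : string) : Prop :=
  [/\ size y = size z, lex_lt y z
    & forall w, size w = size y -> ~ (lex_lt y w /\ lex_lt w z)].

Definition balanced (p : {poly nat}) (M : nptm 1) : Prop :=
  forall x w, is_path M [tuple x] w <-> words p.[size x]%R w.

Definition CLUsharpP : set (string -> nat) :=
  [set f | exists (p : {poly nat}) (M : nptm 1) (b t : string -> string)
             (prec : string -> string -> string -> Prop),
    [/\ balanced p M, FPt b, FPt t, polytime_predicate3 prec
      & forall x, let n := p.[size x]%R in exists h : string -> string,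
        [/\ set_bij (words n) (words n) h,
            [/\ size (b x) = n, size (t x) = n,
                h (b x) = nseq n false & h (t x) = nseq n true],
            forall y z, words n y -> words n z ->
              (prec x y z <-> lex_succ (h y) (h z)),
            f x <> 0 -> exists l u, [/\ words n l, words n u
              & forall w, words n w ->
                  (accepts M [tuple x] w <-> lex_le (h l) (h w) /\ lex_le (h w) (h u))]
          & f x = #|[pred w : n.-tuple bool | accepts M [tuple x] w]|]]].

(* Main.v *)
Require Import Defs.
From mathcomp Require Import all_boot all_order all_algebra.
From mathcomp Require Import classical_sets functions boolp zify.

Set Implicit Arguments.
Unset Strict Implicit.
Unset Printing Implicit Defensive.

Import GRing.Theory.

(** If UP = coUP, then for [f] in CLU#P every [x] has exactly one certificate:
    either the last path counted by [f x] together with its successor in the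
    cyclic order, or a UP witness of [f x = 0]. Given the certificate, the order
    of [f] can be rotated so that the counted paths form a final segment, and the
    reversed order of [g] so that the paths counted by [g] form an initial one.
    With the certificates ordered lexicographically and the two rotated orders
    put one after the other for each of them, the paths counted by [f] and [g]
    form a single interval.

    Conversely, the characteristic function of a UP language [L] is in CLU#P.
    If adding 1 to it does not leave CLU#P, then [x] is outside [L] iff the
    counted interval is a singleton, and this has a unique witness: the element
    of the interval with its two cyclic neighbours.

    A function [g] of UPSV_t is in CLU#P without any hypothesis: in lexicographic
    order, the pairs of the accepting path and a [v < g x] form an interval.

    The machines come from a class of polynomial-time string functions that
    contains finite-state transducers and the simulation of a nondeterministic
    machine on a given guess string. It is closed under composition because the
    machine of every component gets tapes of its own, so that nothing has to be
    cleaned up between two calls. *)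

(** * Machines with functional tapes *)

(** An interval may lie anywhere in its order, and its ends need not be computable in polynomial
    time. Two intervals can therefore not simply be placed side by side: each order has to be cut
    next to a boundary that must be guessed. The guess must be unique for the count to stay correct.
    It must also exist when [f x = 0], since otherwise the paths of [g] would have no block to be
    counted in. The empty interval has no last path, and its certificate comes from [UP = coUP],
    applied to the language of all [x] with [0 < f x].

    The successor relation has to describe a total order on all strings of the right length, so
    invalid certificates need an order too, although no path is counted there. Only single steps of
    these orders are known to be checkable in polynomial time. Hence the conditions on certificates
    and witnesses are local: a path, its neighbours, and whether these are counted. The orders are
    closed up to cycles because a path at an end would otherwise lack a neighbour. *)

Section Tapes.
Variable aux : finType.
Notation sym := (symbol aux).

(* Cell 0 is the one under the head. *)
Definition ftape := int -> sym.

Definition blank : ftape := fun _ => None.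

(** Zippers that differ only in trailing blanks have the same image, so tapes can be compared by
    equality. *)
Definition abs (t : tape aux) : ftape := fun z =>
  match z with Posz n => nth None t.2 n | Negz n => nth None t.1 n end.

Definition disp (d : direction) : int :=
  match d with MoveL => (-1)%R | Stay => 0%R | MoveR => 1%R end.

Definition shift (k : int) (T : ftape) : ftape := fun z => T (z + k)%R.

Definition upd (T : ftape) (k : int) (s : sym) : ftape :=
  fun z => if z == k then s else T z.

Definition fstep (m : sym * direction) (T : ftape) : ftape :=
  shift (disp m.2) (upd T 0%R m.1).

Lemma shift0 T : shift 0%R T = T.
Proof. by apply: funext => z; rewrite /shift addr0. Qed.

Lemma shift_at0 k T : shift k T 0%R = T k.
Proof. by rewrite /shift add0r. Qed.

Lemma upd_id T k : upd T k (T k) = T.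
Proof. by apply: funext => z; rewrite /upd; case: eqP => // ->. Qed.

Lemma fstep_shift s d k T :
  fstep (s, d) (shift k T) = shift (k + disp d)%R (upd T k s).
Proof.
apply: funext => z; rewrite /fstep /shift /upd /= -addrA [(disp d + k)%R]addrC.
by have -> : (z + disp d == 0)%R = (z + (k + disp d) == k)%R by lia.
Qed.

Lemma fstep_id T : fstep (T 0%R, Stay) T = T.
Proof. by rewrite /fstep /= upd_id shift0. Qed.

Lemma fstep_move T d : fstep (T 0%R, d) T = shift (disp d) T.
Proof. by rewrite /fstep upd_id. Qed.

Lemma abs_read t : abs t 0%R = read_tape t.
Proof. by case: t => l [|]. Qed.

Lemma abs_step m t :
  abs (move_head m.2 (write_tape m.1 t)) = fstep m (abs t).
Proof.
case: m t => s d [l r]; apply: funext => z; rewrite /fstep /shift /upd /=.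
case: d => /=.
- case: z => [[|n]|n]; [by case: l|idtac|idtac].
  + have -> : (Posz n.+1 + -1)%R = Posz n by lia.
    by case: n => [|n] /=; rewrite ?nth_behead.
  + have -> : (Negz n + -1)%R = Negz n.+1 by lia.
    by rewrite /= nth_behead.
- by rewrite addr0; case: z => [[|n]|n] //=; rewrite nth_behead.
- case: z => [n|[|n]]; [idtac|by case: r|idtac].
  + have -> : (Posz n + 1)%R = Posz n.+1 by lia.
    by rewrite /= nth_behead.
  + by have -> : (Negz n.+1 + 1)%R = Negz n by lia.
Qed.

Definition obit (s : sym) : option bool := if s is Some (inl b) then Some b else None.

Definition bits (s : string) : seq sym := [seq Some (inl b) | b <- s].

(** The bound includes the cell after [s], which must not hold a bit. So [s] is the longest bit
    string at the head, and the cells further right are arbitrary. *)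
Definition has_out (T : ftape) (s : string) : Prop :=
  forall k, k <= size s -> obit (T (Posz k)) = onth s k.

Lemma nth_bits s k : nth None (bits s) k = omap inl (onth s k).
Proof. by elim: s k => [|b s IH] [|k] //=. Qed.

Lemma obit_bits s k : obit (nth None (bits s) k) = onth s k.
Proof. by rewrite nth_bits; case: onth. Qed.

Lemma has_out_abs l s : has_out (abs (l, bits s)) s.
Proof. by move=> k _; rewrite /= obit_bits. Qed.

Lemma has_out_inj T s s' : has_out T s -> has_out T s' -> s = s'.
Proof.
move=> h h'; have [le|lt] := leqP (size s) (size s').
- apply: eq_from_onth_le => k; rewrite (maxn_idPr le) => lk.
  have [lk'|lk'] := leqP k (size s); first by rewrite -h // -h' // ltnW.
  move: (onthTE s' (size s)); rewrite -h' // h // (onth_default (leqnn _)).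
  by move=> /esym/negbT; lia.
- move: (onthTE s (size s')); rewrite -h ?(ltnW lt) // h' // (onth_default (leqnn _)).
  by rewrite lt.
Qed.

End Tapes.

(** * Runs of components and their sequential composition *)

Section Components.
Variables I aux : finType.
Notation sym := (symbol aux).

(* A machine whose tapes are indexed by an arbitrary finite type; the verdict
   carried by [Halt] is ignored. *)
Record component := Component {
  cstate : finType;
  cstart : cstate;
  cdelta : cstate -> {ffun I -> sym} -> transition (cstate * (I -> sym * direction))
}.

Definition store := I -> ftape aux.

Definition fapply (Q : Type) (m : Q * (I -> sym * direction)) (T : store) : Q * store :=
  (m.1, fun i => fstep (m.2 i) (T i)).

Definition reads (T : store) : {ffun I -> sym} := [ffun i => T i 0%R].

(* The result consists of the unused guesses and the final tapes. *)
Fixpoint crun (C : component) (n : nat) (w : string) (c : cstate C * store) :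
    option (string * store) :=
  match cdelta c.1 (reads c.2), n with
  | Halt _, _ => Some (w, c.2)
  | Step m, n'.+1 => crun n' w (fapply m c.2)
  | Guess m0 m1, n'.+1 =>
      if w is b :: w' then crun n' w' (fapply (if b then m1 else m0) c.2) else None
  | _, 0 => None
  end.

Lemma crun_halt C n w (q : cstate C) T b :
  cdelta q (reads T) = Halt b -> crun n w (q, T) = Some (w, T).
Proof. by case: n => [|n] /= ->. Qed.

Lemma crun_step C n w (q : cstate C) T m : cdelta q (reads T) = Step m ->
  crun n.+1 w (q, T) = crun n w (m.1, fun i => fstep (m.2 i) (T i)).
Proof. by move=> /= ->. Qed.

Lemma crun_guess C n b w (q : cstate C) T m0 m1 (m := if b then m1 else m0) :
  cdelta q (reads T) = Guess m0 m1 ->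
  crun n.+1 (b :: w) (q, T) = crun n w (m.1, fun i => fstep (m.2 i) (T i)).
Proof. by move=> /= ->. Qed.

Definition exec C n w T r := crun n w (cstart C, T) = Some r.

Lemma crun_mono C n m w (c : cstate C * store) r :
  n <= m -> crun n w c = Some r -> crun m w c = Some r.
Proof.
elim: n m w c => [|n IH] [|m] w c //=; case: cdelta => //= [a|a0 a1].
- by move=> lnm; apply: IH.
- by case: w => // b w lnm; apply: IH.
Qed.

Lemma exec_mono C n m w T r : n <= m -> exec C n w T r -> exec C m w T r.
Proof. exact: crun_mono. Qed.

Lemma crun_cat C n w v (c : cstate C * store) w' T :
  crun n w c = Some (w', T) -> crun n (w ++ v) c = Some (w' ++ v, T).
Proof.
elim: n w c => [|n IH] w c /=; first by case: cdelta => //= _ [<- <-].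
case: cdelta => /= [_ [<- <-]//|a|a0 a1].
- exact: IH.
- by case: w => // b w; apply: IH.
Qed.

Lemma exec_cat C n w v T w' T' :
  exec C n w T (w', T') -> exec C n (w ++ v) T (w' ++ v, T').
Proof. exact: crun_cat. Qed.

Definition bounded L (T : store) := forall i z, L < `|z|%N -> T i z = None.

Lemma bounded_apply Q (m : Q * (I -> sym * direction)) L T :
  bounded L T -> bounded L.+1 (fapply m T).2.
Proof.
move=> bT i z lz /=; rewrite /fstep /shift /upd.
by case: eqP => h; [|apply: bT]; move: h lz; case: (m.2 i).2 => /=; lia.
Qed.

Lemma bounded_run C n w (c : cstate C * store) L w' T' :
  bounded L c.2 -> crun n w c = Some (w', T') -> bounded (L + n) T'.
Proof.
elim: n w c L => [|n IH] w c L bc /=.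
  by case: cdelta => // _ [_ <-]; rewrite addn0.
case: cdelta => [_ [_ <-]|a|a0 a1].
- by move=> i z lz; apply: bc; lia.
- by rewrite addnS -addSn; apply: IH; apply: bounded_apply.
- by case: w => // b w; rewrite addnS -addSn; apply: IH; apply: bounded_apply.
Qed.

Lemma bounded_out L T i s : bounded L T -> has_out (T i) s -> size s <= L.+1.
Proof.
move=> bT hs; rewrite leqNgt; apply/negP => ls.
by move: (onthTE s L.+1); rewrite -hs ?(ltnW ls) // bT // ls.
Qed.

(** Each step moves a head by at most one cell, so after [n] steps all nonblank cells are within
    distance [L + n] of the heads. This bounds intermediate results, and with them the running time
    of compositions. *)
Lemma exec_out_size C n w T r L i s :
  bounded L T -> exec C n w T r -> has_out (r.2 i) s -> size s <= (L + n).+1.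
Proof.
case: r => w' T' bT ex; apply: bounded_out.
exact: (bounded_run (c := (cstart C, T)) bT ex).
Qed.

Definition tr_map A B (f : A -> B) (t : transition A) : transition B :=
  match t with
  | Halt b => Halt b
  | Step m => Step (f m)
  | Guess m0 m1 => Guess (f m0) (f m1)
  end.

Definition relabel Q Q' (f : Q -> Q') (m : Q * (I -> sym * direction)) := (f m.1, m.2).

(** When [C1] halts, the first transition of [C2] is taken in the same step, so the handover is free
    and the running times just add up. *)
Definition cseq (C1 C2 : component) : component := @Component (cstate C1 + cstate C2)%type (inl (cstart C1))
  (fun q r => match q with
   | inl q1 => match cdelta q1 r with
               | Halt _ => tr_map (relabel inr) (cdelta (cstart C2) r)
               | t => tr_map (relabel inl) t
               end
   | inr q2 => tr_map (relabel inr) (cdelta q2 r)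
   end).

Lemma crun_inr C1 C2 n w (q : cstate C2) T :
  crun (C := cseq C1 C2) n w (inr q, T) = crun n w (q, T).
Proof.
elim: n w q T => [|n IH] w q T /=; case: cdelta => //= [a|a0 a1].
- exact: IH.
- by case: w => // b w; rewrite -IH; case: b.
Qed.

Lemma crun_seq C1 C2 n1 n2 w (q : cstate C1) T w1 T1 r :
  crun n1 w (q, T) = Some (w1, T1) -> exec C2 n2 w1 T1 r ->
  crun (C := cseq C1 C2) (n1 + n2) w (inl q, T) = Some r.
Proof.
move=> + h2.
have exit w' (q' : cstate C1) T' b : cdelta q' (reads T') = Halt b -> (w', T') = (w1, T1) ->
    crun (C := cseq C1 C2) n2 w' (inl q', T') = Some r.
  move=> E [ew eT]; subst w1 T1; move: h2; rewrite /exec.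
  case: n2 => [|m] /=; rewrite E; case: cdelta => //= [a|a0 a1]; rewrite ?crun_inr //.
  by case: w' => // -[] w'; rewrite crun_inr.
elim: n1 w q T => [|n IH] w q T /=.
  case E: cdelta => [b||] // [ew eT]; exact: (exit _ _ _ _ E (congr2 pair ew eT)).
case E: cdelta => [b|a|a0 a1] /=.
- move=> [ew eT].
  have lm : n2 <= (n + n2).+1 by lia.
  have := crun_mono lm (exit _ _ _ _ E (congr2 pair ew eT)).
  by rewrite /= E.
- exact: IH.
- by case: w => // b w; case: b => /=; apply: IH.
Qed.

Lemma exec_seq C1 C2 n1 n2 w T w1 T1 r :
  exec C1 n1 w T (w1, T1) -> exec C2 n2 w1 T1 r -> exec (cseq C1 C2) (n1 + n2) w T r.
Proof. exact: crun_seq. Qed.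

(** [deterministic] speaks of all states and readings, reachable or not. A run that succeeds on the
    empty guess string never reaches a [Guess], so replacing it by an arbitrary [Halt] does not
    affect the run. *)
Definition noguess (C : component) : component := @Component (cstate C) (cstart C)
  (fun q r => if cdelta q r is Guess _ _ then Halt false else cdelta q r).

Lemma exec_noguess C n T r : exec C n [::] T r -> exec (noguess C) n [::] T r.
Proof.
rewrite /exec /=; move: (cstart C) => q; elim: n q T => [|n IH] q T /=;
  case: cdelta => //= a; exact: IH.
Qed.

End Components.

(** * Running a component on a part of the tapes *)

Section Embedding.
Variables (I J aux auxJ : finType) (C : component J auxJ).
Variables (f : J -> I) (f' : I -> option J) (g : auxJ -> aux) (g' : aux -> option auxJ).
Hypotheses (fK : pcancel f f') (f'K : ocancel f' f) (gK : pcancel g g').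

Definition emb (s : symbol auxJ) : symbol aux :=
  match s with Some (inl b) => Some (inl b) | Some (inr a) => Some (inr (g a)) | None => None end.

Definition unemb (s : symbol aux) : symbol auxJ :=
  match s with
  | Some (inl b) => Some (inl b) | Some (inr a) => omap inr (g' a) | None => None
  end.

Lemma embK : cancel emb unemb.
Proof. by case=> [[b|a]|] //=; rewrite gK. Qed.

Lemma obit_emb s : obit (emb s) = obit s.
Proof. by case: s => [[]|]. Qed.

Definition cembed : component I aux := @Component I aux (cstate C) (cstart C) (fun q r =>
  tr_map (fun m => (m.1, fun i => if f' i is Some j then (emb (m.2 j).1, (m.2 j).2)
                                  else (r i, Stay)))
    (cdelta q [ffun j => unemb (r (f j))])).

Definition overlay (T : store I aux) (TJ : store J auxJ) : store I aux :=
  fun i => if f' i is Some j then emb \o TJ j else T i.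

Lemma fapply_overlay Q (m : Q * (J -> symbol auxJ * direction)) T TJ :
  fapply (m.1, fun i => if f' i is Some j then (emb (m.2 j).1, (m.2 j).2)
                        else (reads (overlay T TJ) i, Stay)) (overlay T TJ) =
  (m.1, overlay T (fapply m TJ).2).
Proof.
congr pair; apply: funext => i; rewrite /= /reads ffunE /overlay.
case E: (f' i) => [j|]; last by rewrite fstep_id.
apply: funext => z; rewrite /fstep /shift /upd /=.
by case: eqP.
Qed.

Lemma reads_overlay T TJ : [ffun j => unemb (reads (overlay T TJ) (f j))] = reads TJ.
Proof. by apply/ffunP => j; rewrite !ffunE /overlay fK /= embK. Qed.

Lemma crun_embed n w q T TJ w' TJ' :
  crun (C := C) n w (q, TJ) = Some (w', TJ') ->
  crun (C := cembed) n w (q, overlay T TJ) = Some (w', overlay T TJ').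
Proof.
elim: n w q TJ => [|n IH] w q TJ /=; rewrite reads_overlay.
  by case: cdelta => //= _ [<- <-].
case: cdelta => /= [_ [<- <-]//|a|a0 a1].
- by rewrite (fapply_overlay a); case: a => q' a; apply: IH.
- case: w => // -[] w; first by rewrite (fapply_overlay a1); case: a1 => ? ?; apply: IH.
  by rewrite (fapply_overlay a0); case: a0 => ? ?; apply: IH.
Qed.

Lemma exec_embed n w T TJ w' TJ' :
  exec C n w TJ (w', TJ') -> (forall j, T (f j) = emb \o TJ j) ->
  exec cembed n w T (w', overlay T TJ').
Proof.
move=> ex hT; have := crun_embed T ex; suff -> : overlay T TJ = T by [].
apply: funext => i; rewrite /overlay; have := f'K i.
by case: (f' i) => [j|] //= <-; rewrite hT.
Qed.

Lemma has_out_emb (t : ftape auxJ) s : has_out t s -> has_out (emb \o t) s.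
Proof. by move=> h k lk /=; rewrite obit_emb h. Qed.

End Embedding.

(** * Copying strings between tapes *)

Section Copy.
Variables (I aux : finType) (src : I -> option I) (c : I).
Notation sym := (symbol aux).

Definition is_src i := [exists d, src d == Some i].

Definition keep_bit (s : sym) : sym := if obit s is Some b then Some (inl b) else None.

Definition one : sym := Some (inl true).

Definition moving i := [|| i == c, isSome (src i) | is_src i].

Definition more (r : {ffun I -> sym}) :=
  [exists d, if src d is Some s then isSome (obit (r s)) else false].

Definition copy_action (s0 : sym) (dir : direction) (r : {ffun I -> sym}) (i : I) :=
  (if i == c then s0 else if src i is Some s then keep_bit (r s) else r i,
   if moving i then dir else Stay).

Definition walk_action (s0 : sym) (dir : direction) (r : {ffun I -> sym}) (i : I) :=
  (if i == c then s0 else r i, if moving i then dir else Stay).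

(* Each tape [d] with [src d = Some s] receives the bit string at the head of
   the tape [s], all at the same time. The heads mark their way to the right on
   the blank tape [c], and use the marks to find their way back. *)
Definition copy : component I aux := @Component I aux (option bool) (Some true) (fun q r =>
  match q with
  | None => Halt false
  | Some true => if more r then Step (Some true, copy_action one MoveR r)
                 else Step (Some false, copy_action None MoveL r)
  | Some false => if r c == one then Step (Some false, walk_action None MoveL r)
                  else Step (None, walk_action None MoveR r)
  end).

Definition copied (N : nat) (T : store I aux) : store I aux := fun i z =>
  if src i is Some s then if (0 <= z < Posz N)%R then keep_bit (T s z) else T i z
  else T i z.

Hypothesis src_c : src c = None.
Hypothesis is_src_c : is_src c = false.
Hypothesis src_src : forall d s, src d = Some s -> src s = None.

Section Run.
Variables (T : store I aux) (N : nat).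
Hypothesis Tc : T c = blank aux.
Hypothesis N_more : forall k, k < N -> more [ffun i => T i (Posz k)].
Hypothesis N_stop : more [ffun i => T i (Posz N)] = false.

Definition marks (k : nat) : ftape aux := fun z => if (0 <= z < Posz k)%R then one else None.

(** The situation with [m] marks written, [k] cells copied and all moving heads at position [p]. *)
Definition copy_store (m k : nat) (p : int) : store I aux := fun i =>
  shift (if moving i then p else 0%R)
    (if i == c then marks m else copied k T i).

Lemma reads_copy_store m k p i : reads (copy_store m k p) i =
  if i == c then marks m p else copied k T i (if moving i then p else 0%R).
Proof.
rewrite ffunE /copy_store /shift add0r; case: eqP => // ->.
by rewrite /moving eqxx.
Qed.

Lemma reads_src m k p d s : src d = Some s ->
  reads (copy_store m k p) s = T s p.
Proof.
move=> ds; rewrite reads_copy_store.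
have ss : is_src s by apply/existsP; exists d; apply/eqP.
have /negbTE -> : s != c by apply: contraTneq ss => ->; rewrite is_src_c.
by rewrite /copied (src_src ds) /moving ss !orbT.
Qed.

Lemma more_copy_store m k p : more (reads (copy_store m k p)) = more [ffun i => T i p].
Proof.
apply: eq_existsb => d; case E: (src d) => [s|] //.
by rewrite (reads_src _ _ _ E) ffunE.
Qed.

Lemma copied_step k i z s : src i = Some s ->
  upd (copied k T i) (Posz k) (keep_bit (T s (Posz k))) z = copied k.+1 T i z.
Proof.
move=> E; rewrite /upd /copied E; case: eqP => [->|zk]; first by have -> : (0 <= Posz k < Posz k.+1)%R by lia.
by have -> : (0 <= z < Posz k.+1)%R = (0 <= z < Posz k)%R by lia.
Qed.

Lemma copy_act s0 dir m m' k (p' := (Posz k + disp dir)%R) :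
  upd (marks m) (Posz k) s0 = marks m' ->
  (fun i => fstep (copy_action s0 dir (reads (copy_store m k (Posz k))) i)
    (copy_store m k (Posz k) i)) = copy_store m' k.+1 p'.
Proof.
move=> hm; apply: funext => i; rewrite {2}/copy_store.
rewrite /copy_action fstep_shift reads_copy_store /copy_store.
case: eqP => [->|/eqP ic]; first by rewrite /moving eqxx /= hm.
case E: (src i) => [s|].
  have -> : moving i by rewrite /moving E orbT.
  by rewrite (reads_src _ _ _ E); congr shift; apply: funext => z; rewrite copied_step.
rewrite upd_id; case: ifP => _; rewrite ?addr0; congr shift;
  by rewrite /copied E.
Qed.

Lemma walk_act s0 dir m m' k p :
  upd (marks m) p s0 = marks m' ->
  (fun i => fstep (walk_action s0 dir (reads (copy_store m k p)) i)
    (copy_store m k p i)) = copy_store m' k (p + disp dir)%R.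
Proof.
move=> hm; apply: funext => i; rewrite {2}/copy_store.
rewrite /walk_action fstep_shift reads_copy_store /copy_store.
case: eqP => [->|/eqP ic]; first by rewrite /moving eqxx /= hm.
by rewrite upd_id; case: ifP => _; rewrite ?addr0.
Qed.

Lemma copy_store0 : copy_store 0 0 0%R = T.
Proof.
apply: funext => i; rewrite /copy_store if_same shift0; case: eqP => [->|_].
  by rewrite Tc; apply: funext => z; rewrite /marks; case: ifP => //; lia.
by apply: funext => z; rewrite /copied; case: src => // s; case: ifP => //; lia.
Qed.

Lemma copy_storeN k : copy_store 0 k 0%R = copied k T.
Proof.
apply: funext => i; rewrite /copy_store if_same shift0; case: eqP => [->|_] //.
apply: funext => z; rewrite /marks /copied src_c Tc; case: ifP => //; lia.
Qed.

(** The marks are erased on the way back. The walk overshoots to the blank cell at -1, and one step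
    to the right restores position 0. *)
Lemma copy_back w j k :
  crun (C := copy) j.+1 w (Some false, copy_store j k (Posz j - 1)%R) =
  Some (w, copied k T).
Proof.
elim: j => [|j IH].
  rewrite (@crun_step _ _ copy _ _ _ _ (None, walk_action None MoveR
    (reads (copy_store 0 k (Posz 0 - 1))))); last first.
    by rewrite /= reads_copy_store eqxx.
  rewrite /= (@walk_act _ _ 0 0) ?copy_storeN //.
  by apply: funext => z; rewrite /upd /marks; case: ifP => _; case: ifP => //; lia.
have -> : (Posz j.+1 - 1 = Posz j)%R by lia.
rewrite (@crun_step _ _ copy _ _ _ _ (Some false, walk_action None MoveL
  (reads (copy_store j.+1 k (Posz j))))); last first.
  rewrite /= reads_copy_store eqxx /marks.
  by have -> : (0 <= Posz j < Posz j.+1)%R by lia.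
rewrite [(_, _).1]/= [(_, _).2]/= (@walk_act _ _ _ j); first exact: IH.
apply: funext => z; rewrite /upd /marks; case: eqP => [->|zk].
  by case: ifP => //; lia.
by have -> : (0 <= z < Posz j.+1)%R = (0 <= z < Posz j)%R by lia.
Qed.

(** The turning step also writes cell [N] of the destinations. No source has a bit there, so
    [keep_bit] writes a blank, which ends the copied string even if the destination held something
    else before; hence [N.+1]. *)
Lemma copy_forth w k : k <= N ->
  crun (C := copy) (N - k + N + 2) w (Some true, copy_store k k (Posz k)) =
  Some (w, copied N.+1 T).
Proof.
move=> kN; rewrite -(subKn kN); move: (N - k) (leq_subr k N) => {k kN} j jN.
have -> : N - (N - j) + N + 2 = (j + N + 2) by lia.
elim: j jN => [|j IH] jN.
  rewrite subn0 add0n addn2.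
  rewrite (@crun_step _ _ copy _ _ _ _ (Some false, copy_action None MoveL
    (reads (copy_store N N (Posz N))))); last by rewrite /= more_copy_store N_stop.
  rewrite [(_, _).1]/= [(_, _).2]/= (@copy_act _ _ _ N); first exact: copy_back.
  apply: funext => z; rewrite /upd /marks; case: eqP => [->|//].
  by case: ifP => //; lia.
set k := N - j.+1; rewrite !addSn.
rewrite (@crun_step _ _ copy _ _ _ _ (Some true, copy_action one MoveR
    (reads (copy_store k k (Posz k))))); last first.
  by rewrite /= more_copy_store N_more // /k; lia.
rewrite [(_, _).1]/= [(_, _).2]/= (@copy_act _ _ _ k.+1).
  have -> : k.+1 = N - j by rewrite /k; lia.
  have -> : (Posz k + disp MoveR)%R = Posz (N - j) by rewrite /k /=; lia.
  by apply: IH; lia.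
apply: funext => z; rewrite /upd /marks; case: eqP => [->|zk]; first by case: ifP => //; lia.
by have -> : (0 <= z < Posz k.+1)%R = (0 <= z < Posz k)%R by lia.
Qed.

End Run.

(** Sources of different lengths are copied together. Only a bound [B] on their ends is given; [N]
    is the first position where no source has a bit. *)
Lemma exec_copy B w (T : store I aux) : T c = blank aux ->
  (forall d s, src d = Some s -> obit (T s (Posz B)) = None) ->
  exists N, [/\ N <= B, exec copy (2 * B + 2) w T (w, copied N.+1 T)
    & forall d s, src d = Some s -> obit (T s (Posz N)) = None].
Proof.
move=> Tc TB; pose P n := ~~ more [ffun i => T i (Posz n)].
have PE n : P n -> forall d s, src d = Some s -> obit (T s (Posz n)) = None.
  move=> /existsPn hP d s E; have := hP d; rewrite E ffunE; by case: obit.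
have exP : exists n, P n.
  exists B; apply/existsPn => d; case E: (src d) => [s|] //.
  by rewrite ffunE (TB _ _ E).
case: (ex_minnP exP) => N PN minN.
have NB : N <= B.
  apply: minN; apply/existsPn => d; case E: (src d) => [s|] //.
  by rewrite ffunE (TB _ _ E).
exists N; split => //; last exact: PE.
have more_lt k : k < N -> more [ffun i => T i (Posz k)].
  by move=> kN; apply: contraTT kN => /minN; rewrite -leqNgt.
have := copy_forth Tc more_lt (negbTE PN) w (leq0n N).
rewrite (copy_store0 Tc (negbTE PN)) => h; apply: exec_mono h; lia.
Qed.

End Copy.

(** * Polynomial-time functions and their composition *)

Lemma horner_mono (p : {poly nat}) m n : m <= n -> p.[m]%R <= p.[n]%R.
Proof.
move=> mn; elim/poly_ind: p => [|p c IH]; first by rewrite !horner0.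
by rewrite !hornerMXaddC leq_add2r leq_mul.
Qed.

Definition poly_bounded (T : nat -> nat) := exists p : {poly nat}, forall n, T n <= p.[n]%R.

Lemma poly_bounded_horner (p : {poly nat}) : poly_bounded (fun n => p.[n]%R).
Proof. by exists p. Qed.

Lemma poly_bounded_id : poly_bounded id.
Proof. by exists 'X%R => n; rewrite hornerX. Qed.

Lemma poly_bounded_const c : poly_bounded (fun=> c).
Proof. by exists (c%:P)%R => n; rewrite hornerC. Qed.

Lemma poly_bounded_add T U :
  poly_bounded T -> poly_bounded U -> poly_bounded (fun n => T n + U n).
Proof.
move=> [p hp] [q hq]; exists (p + q)%R => n.
by rewrite hornerD leq_add.
Qed.

Lemma poly_bounded_mul T U :
  poly_bounded T -> poly_bounded U -> poly_bounded (fun n => T n * U n).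
Proof.
move=> [p hp] [q hq]; exists (p * q)%R => n.
by rewrite hornerM leq_mul.
Qed.

Lemma poly_bounded_comp T U :
  poly_bounded T -> poly_bounded U -> poly_bounded (fun n => T (U n)).
Proof.
move=> [p hp] [q hq]; exists (p \Po q)%R => n; rewrite horner_comp.
exact: leq_trans (hp _) (horner_mono p (hq n)).
Qed.

Lemma poly_bounded_S T : poly_bounded T -> poly_bounded (fun n => (T n).+1).
Proof.
move=> /(poly_bounded_add (poly_bounded_const 1)) [p hp].
by exists p => n; apply: leq_trans (hp n); rewrite add1n.
Qed.

Ltac poly_bound := repeat first
  [ apply: poly_bounded_horner | apply: poly_bounded_const | apply: poly_bounded_id
  | apply: poly_bounded_S | apply: poly_bounded_add | apply: poly_bounded_mul
  | apply: (poly_bounded_comp (poly_bounded_horner _)) ].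

Section Size.
Variable V : finType.
Implicit Type e : V -> string.

Definition esize e := \sum_v size (e v).

Lemma size_le_esize e v : size (e v) <= esize e.
Proof. by rewrite /esize (bigD1 v) //= leq_addr. Qed.

Definition extend e (s : string) : option V -> string :=
  fun o => if o is Some v then e v else s.

End Size.

Lemma esize_extend (V : finType) (e : V -> string) s : esize (extend e s) = size s + esize e.
Proof.
rewrite /esize (bigD1 None) //=; congr (_ + _).
rewrite (reindex_omap (Some : V -> option V) id) //=; last by case.
by apply: eq_bigl => v; rewrite eqxx.
Qed.

Section Environments.
Variable V : finType.
Implicit Type e : V -> string.

Definition tape_of aux e (o : option V) : ftape aux :=
  if o is Some v then abs ([::], bits aux (e v)) else blank aux.

Lemma emb_abs_bits (aux aux' : finType) (g : aux -> aux') s :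
  emb g \o abs ([::], bits aux s) = abs ([::], bits aux' s).
Proof.
apply: funext => -[n|n] /=; last by rewrite !nth_nil.
by rewrite !nth_bits; case: onth.
Qed.

Lemma emb_tape_of (aux aux' : finType) (g : aux -> aux') e o :
  emb g \o tape_of aux e o = tape_of aux' e o.
Proof. by case: o => //= v; rewrite emb_abs_bits. Qed.

Lemma bounded_tape_of (I aux : finType) e (inpt : I -> option V) :
  bounded (esize e) (fun i => tape_of aux e (inpt i)).
Proof.
move=> i [n|n] /= h; case: (inpt i) => [v|] //=; last by rewrite nth_nil.
by rewrite nth_bits onth_default //; apply: leq_trans (ltnW h); apply: size_le_esize.
Qed.

(* An input string may be given on several tapes, or on none. *)
Definition NFP (N : (V -> string) -> nat) (F : (V -> string) -> string -> string) : Prop :=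
  exists (I aux : finType) (C : component I aux) (inpt : I -> option V) (out : I)
    (p : {poly nat}), forall e w, size w = N e ->
    exists2 T, exec C p.[esize e]%R w (fun i => tape_of aux e (inpt i)) ([::], T)
             & has_out (T out) (F e w).

Definition FP (F : (V -> string) -> string) : Prop := NFP (fun=> 0) (fun e _ => F e).

End Environments.

Lemma copied_bits (I aux : finType) (src : I -> option I) N (T : store I aux) d s x :
  src d = Some s -> T d = blank aux -> (forall k, k <= N -> obit (T s (Posz k)) = onth x k) ->
  size x <= N -> copied src N.+1 T d = abs ([::], bits aux x).
Proof.
move=> E Td Ts xN; apply: funext => -[k|k]; rewrite /copied E Td /=; last first.
  by rewrite ?nth_nil.
rewrite nth_bits; case: ifP => h.
  by rewrite /keep_bit Ts; [case: onth|lia].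
by rewrite onth_default //; lia.
Qed.

(** * Substitution and composition *)

Section Let.
Variables (V : finType) (N : (V -> string) -> nat) (F : (V -> string) -> string -> string)
  (G : (option V -> string) -> string).

(** The second machine's tapes carry the original inputs from the beginning and are not touched by
    the first. Only the new variable [None], the result of the first machine, has to be copied to
    them. *)
Lemma NFP_let : NFP N F -> FP G -> NFP N (fun e w => G (extend e (F e w))).
Proof.
move=> [I1 [aux1 [C1 [in1 [out1 [p1 h1]]]]]] [I2 [aux2 [C2 [in2 [out2 [p2 h2]]]]]].
pose I : finType := (I1 + I2 + unit)%type.
pose aux : finType := (aux1 + aux2)%type.
pose f1 (j : I1) : I := inl (inl j).
pose f1' (i : I) := if i is inl (inl j) then Some j else None.
pose f2 (j : I2) : I := inl (inr j).
pose f2' (i : I) := if i is inl (inr j) then Some j else None.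
pose g1' (a : aux) := if a is inl b then Some b else None.
pose g2' (a : aux) := if a is inr b then Some b else None.
have f1K : pcancel f1 f1' by []. have f2K : pcancel f2 f2' by [].
have f1'K : ocancel f1' f1 by case=> [[]|]. have f2'K : ocancel f2' f2 by case=> [[]|].
have g1K : pcancel inl g1' by []. have g2K : pcancel inr g2' by [].
pose src (i : I) := if f2' i is Some j then
  (if in2 j is Some None then Some (f1 out1) else None) else None.
pose inpt (i : I) : option V := match i with
  | inl (inl j) => in1 j | inl (inr j) => obind id (in2 j) | inr _ => None end.
pose c : I := inr tt.
pose C := cseq (cembed C1 f1 f1' (inl : aux1 -> aux) g1')
         (cseq (copy aux src c) (cembed C2 f2 f2' (inr : aux2 -> aux) g2')).
(* The intermediate result has at most [(n + p1.[n]).+1] symbols. This bounds the copying time, and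
   together with [n] the input size of the second machine. *)
have [p hp] : poly_bounded (fun n =>
    p1.[n]%R + ((2 * (n + p1.[n]%R).+1 + 2) + p2.[((n + p1.[n]%R).+1 + n)%N]%R)).
  by poly_bound.
exists I, aux, C, inpt, (f2 out2), p => e w sw.
have [T1 ex1 o1] := h1 e w sw; set s := F e w in o1 *.
have ss : size s <= (esize e + p1.[esize e]%R).+1.
  exact: exec_out_size (@bounded_tape_of _ _ _ e in1) ex1 o1.
have [T2 ex2 o2] := h2 (extend e s) [::] erefl.
pose T0 : store I aux := fun i => tape_of aux e (inpt i).
have {}ex1 := exec_embed f1K f1'K g1K ex1 (T := T0).
have {ex1} := ex1 (fun j => esym (emb_tape_of _ _ _)).
set T0' := overlay _ _ _ _ => ex1.
have outT0' : has_out (T0' (f1 out1)) s by apply: has_out_emb.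
have [||||M [MB exc stop]] := @exec_copy _ _ src c _ _ _ (size s) [::] T0' erefl.
- by [].
- by apply/negbTE/existsPn => -[[j|j]|j] //; rewrite /src /=; case: (in2 j) => [[]|].
- by move=> [[j|j]|j] s' //; rewrite /src /=; case: (in2 j) => [[]|] // [<-].
- move=> [[j|j]|j] s' //; rewrite /src /=; case: (in2 j) => [[]|] // [<-].
  by rewrite outT0' // onth_default.
set T0'' := copied _ _ _ in exc.
have {}ex2 := exec_embed f2K f2'K g2K ex2 (T := T0'').
have hT2 j : T0'' (f2 j) = emb (inr : aux2 -> aux) \o tape_of aux2 (extend e s) (in2 j).
  rewrite emb_tape_of /T0''.
  case E: (in2 j) => [[v|]|] /=; try by apply: funext => z; rewrite /copied /src /= E /T0' /overlay /= /T0 /= E.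
  have sj : src (f2 j) = Some (f1 out1) by rewrite /src /= E.
  have Ms : size s <= M.
    by rewrite -onthNE -outT0' // (stop _ _ sj).
  apply: (copied_bits sj) => // [|k kM]; last by rewrite outT0' // (leq_trans kM).
  by rewrite /T0' /overlay /= /T0 /= E.
have {ex2} := ex2 hT2.
set Tf := overlay _ _ _ _ => ex2; exists Tf; last exact: has_out_emb.
apply: exec_mono (exec_seq ex1 (exec_seq exc ex2)).
apply: leq_trans (hp (esize e)); rewrite leq_add2l leq_add //; first by lia.
by apply: horner_mono; rewrite esize_extend leq_add2r.
Qed.

End Let.

Lemma FP_ext (V : finType) (F G : (V -> string) -> string) : F =1 G -> FP F -> FP G.
Proof. by move=> /funext ->. Qed.

Lemma FP_let (V : finType) (F : (V -> string) -> string) (G : (option V -> string) -> string) :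
  FP F -> FP G -> FP (fun e => G (extend e (F e))).
Proof. exact: NFP_let. Qed.

Lemma FP_reindex (V W : finType) (r : W -> option V) (G : (W -> string) -> string) :
  FP G -> FP (fun e : V -> string => G (fun w => if r w is Some v then e v else [::])).
Proof.
move=> [I [aux [C [inpt [out [p h]]]]]].
(* One variable of [V] may be renamed to every variable of [W], so the input size may grow by the
   factor [#|W|]. *)
have [q hq] : poly_bounded (fun n => p.[(#|W| * n)%N]%R) by poly_bound.
exists I, aux, C, (fun i => obind r (inpt i)), out, q => e w sw.
pose e' w := if r w is Some v then e v else [::].
have [T ex ho] := h e' w sw; exists T => //.
have -> : (fun i => tape_of aux e (obind r (inpt i))) = (fun i => tape_of aux e' (inpt i)).
  apply: funext => i; case: (inpt i) => [u|] //=; rewrite /e'.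
  by case: (r u) => //=; apply: funext => -[z|z]; rewrite /= nth_nil.
apply: exec_mono ex; apply: leq_trans (hq _); apply: horner_mono.
rewrite {1}/esize -sum_nat_const; apply: leq_sum => u _; rewrite /e'.
by case: (r u) => [v|] //; apply: size_le_esize.
Qed.

(** [FP_let] binds one variable at a time. In [H s] the variables in [s] are already substituted;
    the others stand beside those of [V], which remain available for the substitutions to come. *)
Lemma FP_comp (V W : finType) (F : W -> (V -> string) -> string) (G : (W -> string) -> string) :
  (forall w, FP (F w)) -> FP G -> FP (fun e => G (fun w => F w e)).
Proof.
move=> hF hG.
pose H (s : seq W) (e : V + W -> string) :=
  G (fun w => if w \in s then F w (e \o inl) else e (inr w)).
have hH s : FP (H s).
  elim: s => [|w s IH].
    have := @FP_reindex (V + W)%type W (fun w => Some (inr w)) G hG.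
    by apply: FP_ext.
  (* [w] is renamed to the variable that [FP_let] binds. *)
  pose r (u : V + W) : option (option (V + W)) :=
    if u == inr w then Some None else Some (Some u).
  have := FP_let (@FP_reindex (V + W)%type V (fun v => Some (inl v)) (F w) (hF w))
    (FP_reindex r IH).
  apply: FP_ext => e; rewrite /H; congr G; apply: funext => u.
  rewrite in_cons /r /=; case: (eqVneq u w) => [->|uw] /=.
    by case: ifP => // _; rewrite eqxx.
  by case: ifP => // _; rewrite (inj_eq inr_inj) (negbTE uw).
have := FP_reindex (fun u : V + W => if u is inl v then Some v else None) (hH (enum W)).
by apply: FP_ext => e; congr G; apply: funext => w; rewrite mem_enum.
Qed.

(** * Guessing, and conversion to machines *)

Lemma abs_bits_rcons aux s b :
  upd (abs ([::], bits aux s)) (Posz (size s)) (Some (inl b)) =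
  abs ([::], bits aux (rcons s b)).
Proof.
apply: funext => -[k|k]; rewrite /upd /=; last by rewrite !nth_nil.
rewrite !nth_bits -cats1 onth_cat eqz_nat; case: eqP => [->|nk].
  by rewrite ltnn subnn.
by case: ltnP => // h; rewrite !onth_default //=; lia.
Qed.

Section Rewind.
Variables (I aux : finType) (t : I).

Definition set_tape (T : store I aux) (f : ftape aux) : store I aux :=
  fun i => if i == t then f else T i.

Definition move_tape (d : direction) (r : {ffun I -> symbol aux}) (i : I) :=
  (r i, if i == t then d else Stay).

Lemma move_set_tape d T f p :
  (fun i => fstep (move_tape d (reads (set_tape T (shift p f))) i) (set_tape T (shift p f) i)) =
  set_tape T (shift (p + disp d)%R f).
Proof.
apply: funext => i; rewrite /move_tape ffunE /set_tape; case: eqP => _.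
  by rewrite fstep_shift shift_at0 upd_id.
by rewrite fstep_id.
Qed.

Definition rewind : component I aux := @Component I aux (option bool) (Some true) (fun q r =>
  match q with
  | None => Halt false
  | Some true => Step (Some false, move_tape MoveL r)
  | Some false => if isSome (obit (r t)) then Step (Some false, move_tape MoveL r)
                  else Step (None, move_tape MoveR r)
  end).

Lemma exec_rewind w T s :
  exec rewind (size s + 2) w (set_tape T (shift (Posz (size s)) (abs ([::], bits aux s))))
    (w, set_tape T (abs ([::], bits aux s))).
Proof.
set f := abs _.
have back j : j <= size s ->
    crun (C := rewind) j.+1 w (Some false, set_tape T (shift (Posz j - 1)%R f)) =
    Some (w, set_tape T f).
  elim: j => [|j IH] js.
    rewrite (crun_step (C := rewind) _ _ (m := (None, move_tape MoveR
      (reads (set_tape T (shift (Posz 0 - 1)%R f))))));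
      last by rewrite /= ffunE /set_tape eqxx shift_at0.
    by rewrite [(_, _).2]/= move_set_tape (crun_halt (C := rewind) _ _ (b := false)) //= shift0.
  have -> : (Posz j.+1 - 1 = Posz j)%R by lia.
  rewrite (crun_step (C := rewind) _ _ (m := (Some false, move_tape MoveL
    (reads (set_tape T (shift (Posz j) f))))));
    last by rewrite /= ffunE /set_tape eqxx shift_at0 /f /= obit_bits onthTE js.
  by rewrite [(_, _).2]/= move_set_tape; apply: IH; apply: ltnW.
rewrite /exec addn2 (crun_step (C := rewind) _ _ (m := (Some false, move_tape MoveL
  (reads (set_tape T (shift (Posz (size s)) f)))))) //.
by rewrite [(_, _).2]/= move_set_tape; apply: back.
Qed.

End Rewind.

Section Guess.
Variables (I aux : finType) (u t : I).

Definition guess_action (r : {ffun I -> symbol aux}) (b : bool) (i : I) :=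
  if i == t then (Some (inl b), MoveR) else if i == u then (r i, MoveR) else (r i, Stay).

Definition guess_loop : component I aux := @Component I aux unit tt (fun q r =>
  if isSome (obit (r u)) then Guess (tt, guess_action r false) (tt, guess_action r true)
  else Halt false).

Lemma exec_guess T s w : u != t -> has_out (T u) s -> size w = size s ->
  exec (cseq guess_loop (rewind aux t)) (size s + (size s + 2)) w (set_tape t T (blank aux))
    ([::], set_tape t (set_tape u T (shift (Posz (size s)) (T u))) (abs ([::], bits aux w))).
Proof.
move=> ut hs ws; rewrite -{2}ws; apply: exec_seq; last exact: exec_rewind.
rewrite /exec ws.
have -> : set_tape t T (blank aux) =
    set_tape t (set_tape u T (shift (Posz 0) (T u))) (shift (Posz 0) (abs ([::], bits aux [::]))).
  apply: funext => i; rewrite /set_tape !shift0; case: eqP => _.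
    by apply: funext => -[z|z]; rewrite /= nth_nil.
  by case: eqP => [->|].
have : size ([::] : string) + size w = size s by [].
suff H z : size z + size w = size s ->
    crun (C := guess_loop) (size w) w (tt,
     set_tape t (set_tape u T (shift (Posz (size z)) (T u)))
       (shift (Posz (size z)) (abs ([::], bits aux z)))) =
    Some ([::], set_tape t (set_tape u T (shift (Posz (size s)) (T u)))
       (shift (Posz (size s)) (abs ([::], bits aux (z ++ w))))).
  by move=> /H; rewrite -ws.
elim: w z {ws} => [|b w IH] z zw.
  have E : size z = size s by rewrite -zw addn0.
  rewrite (crun_halt (C := guess_loop) _ _ (b := false)) ?cats0 ?E //=.
  rewrite ffunE /set_tape (negbTE ut) eqxx shift_at0 hs // onth_default //.
set T' := set_tape _ _ _.
rewrite (crun_guess (C := guess_loop) _ _ _ (m0 := (tt, guess_action (reads T') false))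
  (m1 := (tt, guess_action (reads T') true))); last first.
  rewrite /= ffunE /T' /set_tape (negbTE ut) eqxx shift_at0 hs ?onthTE; last by rewrite -zw leq_addr.
  by rewrite -zw addnS ltnS leq_addr.
rewrite -cat_rcons -IH ?size_rcons //; last by rewrite -zw addnS.
have -> : (if b then (tt, guess_action (reads T') true) else (tt, guess_action (reads T') false))
  = (tt, guess_action (reads T') b) by case: (b).
congr crun; congr pair; apply: funext => i; rewrite /= /guess_action ffunE /T' /set_tape.
case: eqP => _.
  by rewrite fstep_shift abs_bits_rcons /= -PoszD addn1.
case: eqP => _; last by rewrite fstep_id.
by rewrite fstep_shift shift_at0 upd_id /= -PoszD addn1.
Qed.

End Guess.

(** The output of [P] is a unary counter: one bit is guessed for each of its symbols. *)
Lemma NFP_guess (V : finType) (P : (V -> string) -> string) :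
  FP P -> NFP (fun e => size (P e)) (fun e w => w).
Proof.
move=> [I1 [aux [C [inpt [out [p h]]]]]].
pose I : finType := (I1 + unit)%type.
pose f' (i : I) := if i is inl j then Some j else None.
have fK : pcancel inl f' by []. have f'K : ocancel f' inl by case.
have gK : pcancel (id : aux -> aux) Some by [].
have [q hq] : poly_bounded (fun n => p.[n]%R + ((n + p.[n]%R).+1 + ((n + p.[n]%R).+1 + 2))).
  by poly_bound.
exists I, aux, (cseq (cembed C (inl : I1 -> I) f' (id : aux -> aux) Some)
  (cseq (guess_loop aux (inl out : I) (inr tt)) (rewind aux (inr tt)))),
  (fun i => if i is inl j then inpt j else None), (inr tt : I), q => e w sw.
have [T1 ex1 o1] := h e [::] erefl.
have ss : size (P e) <= (esize e + p.[esize e]%R).+1.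
  exact: exec_out_size (@bounded_tape_of _ _ _ e inpt) ex1 o1.
pose T0 : store I aux := fun i => tape_of aux e (if i is inl j then inpt j else None).
have := exec_embed fK f'K gK ex1 (T := T0).
move=> /(_ (fun j => esym (emb_tape_of _ _ _)))/(exec_cat w) /=.
set T0' := overlay _ _ _ _ => {}ex1.
have := @exec_guess _ aux (inl out : I) (inr tt) T0' (P e) w erefl (has_out_emb _ o1) sw.
have -> : set_tape (inr tt) T0' (blank aux) = T0'.
  by apply: funext => -[j|[]].
set T2 := set_tape _ _ _ => ex2; exists T2; last by rewrite /T2 /set_tape eqxx; apply: has_out_abs.
apply: exec_mono (exec_seq ex1 ex2).
by apply: leq_trans (hq _); rewrite leq_add2l !leq_add.
Qed.

Local Arguments current : simpl never.

Lemma has_out_bit_prefix (M : machine) (t : tape (Defs.aux M)) :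
  has_out (abs t) (bit_prefix t.2).
Proof.
case: t => l r j; rewrite /=; elim: r j => [|[[b|x]|] r IH] [|j] //=.
exact: IH.
Qed.

(** * From components to machines with numbered tapes *)

Section Machine.
Variables (a : nat) (J aux : finType) (C : component ('I_a.+1 + J)%type aux).
Variable acc : option bool -> bool.
Local Notation I := ('I_a.+1 + J)%type.
Local Notation k := (a + #|J|).

Definition tape_name (i : 'I_k.+1) : I :=
  match fintype.split (i : 'I_(a.+1 + #|J|)) with inl j => inl j | inr l => inr (enum_val l) end.

Definition tape_index (i : I) : 'I_k.+1 :=
  match i with inl j => lshift #|J| j | inr j => rshift a.+1 (enum_rank j) end.

Lemma tape_indexK : cancel tape_index tape_name.
Proof.
case=> j; rewrite /tape_index /tape_name.
  by have := unsplitK (inl j : 'I_a.+1 + 'I_#|J|); rewrite /unsplit => ->.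
have := unsplitK (inr (enum_rank j) : 'I_a.+1 + 'I_#|J|); rewrite /unsplit => ->.
by rewrite enum_rankK.
Qed.

Lemma tape_name0 : tape_name ord0 = inl ord0.
Proof. by rewrite -[RHS]tape_indexK; congr tape_name; apply: val_inj. Qed.

(** Components have no verdict of their own, so [acc] derives it from the symbol under the head of
    tape 0, the first symbol of the output. *)
Definition machine_of : machine := @Machine (cstate C) (cstart C) aux k
  (fun q r =>
     match cdelta q [ffun i => r (tape_index i)] with
     | Halt _ => Halt (acc (obit (r ord0)))
     | Step m => Step (m.1, m.2 \o tape_name)
     | Guess m0 m1 => Guess (m0.1, m0.2 \o tape_name) (m1.1, m1.2 \o tape_name)
     end).

Definition simulates (c : config machine_of) (q : cstate C) (T : store I aux) :=
  c.1 = q /\ forall i, abs (c.2 i) = T (tape_name i).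

Lemma simulates_current c q T : simulates c q T ->
  current c = match cdelta q (reads T) with
     | Halt _ => Halt (acc (obit (T (inl ord0) 0%R)))
     | Step m => Step (m.1, m.2 \o tape_name)
     | Guess m0 m1 => Guess (m0.1, m0.2 \o tape_name) (m1.1, m1.2 \o tape_name)
     end.
Proof.
case: c => q' c [/= -> cT]; rewrite /current /=.
have -> : [ffun i => [ffun i0 => read_tape (c i0)] (tape_index i)] = reads T.
  by apply/ffunP => i; rewrite !ffunE -abs_read cT tape_indexK.
by rewrite ffunE -abs_read cT tape_name0.
Qed.

Lemma simulates_apply c q T (m : cstate C * (I -> symbol aux * direction)) :
  simulates c q T ->
  simulates (apply_action (M := machine_of) (m.1, m.2 \o tape_name) c) m.1 (fapply m T).2.
Proof.
case: c => q' c [/= _ cT]; split => // i.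
by rewrite /apply_action /= abs_step cT.
Qed.

Lemma run_machine_of n w c q T : simulates c q T ->
  match crun n w (q, T) with
  | Some ([::], T') => exists2 o,
      run (M := machine_of) n w c = Some (acc (obit (T' (inl ord0) 0%R)), o)
    & forall s, has_out (T' (inl ord0)) s -> o = s
  | _ => run (M := machine_of) n w c = None
  end.
Proof.
have halt c' q' T' : simulates c' q' T' -> forall s, has_out (T' (inl ord0)) s -> output c' = s.
  move=> [_ cT] s; rewrite -tape_name0 -cT => hs.
  exact: has_out_inj (@has_out_bit_prefix machine_of (c'.2 ord0)) hs.
elim: n w c q T => [|n IH] w c q T cT; rewrite /= (simulates_current cT);
  case: cdelta => [b|m|m0 m1] /=.
- by case: w => [|b' w] //; eexists; last exact: halt cT.
- by case: w.
- by case: w.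
- by case: w => [|b' w] //; eexists; last exact: halt cT.
- exact: IH (simulates_apply m cT).
- case: w => // -[] w; first exact: IH (simulates_apply m1 cT).
  exact: IH (simulates_apply m0 cT).
Qed.

(** Every branch is followed by some guess string of length at least [L], so such strings suffice to
    control the whole computation tree. On shorter ones [crun] may fail merely because the guesses
    run out. *)
Lemma halts_machine_of n L c q T : simulates c q T ->
  (forall w, L <= size w -> crun n w (q, T) <> None) -> halts_within (M := machine_of) n c.
Proof.
elim: n L c q T => [|n IH] L c q T cT; rewrite /= (simulates_current cT) => h;
  case E: cdelta h => [b|m|m0 m1] //= h.
- by case: (h (nseq L true)); rewrite ?size_nseq.
- by case: (h (nseq L true)); rewrite ?size_nseq.
- exact: IH (simulates_apply m cT) h.
- apply/andP; split.
  + by apply: (IH L _ _ _ (simulates_apply m0 cT)) => w lw; apply: (h (false :: w)); apply: leqW.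
  + by apply: (IH L _ _ _ (simulates_apply m1 cT)) => w lw; apply: (h (true :: w)); apply: leqW.
Qed.

Variables (N : ('I_a.+1 -> string) -> nat) (F : ('I_a.+1 -> string) -> string -> string).
Variable p : {poly nat}.
Definition input_store (e : 'I_a.+1 -> string) : store I aux := fun i =>
  if i is inl v then abs ([::], bits aux (e v)) else blank aux.

Hypothesis computes : forall e w, size w = N e ->
  exists2 T, exec C p.[esize e]%R w (input_store e) ([::], T) & has_out (T (inl ord0)) (F e w).

Lemma simulates_init (xs : a.+1.-tuple string) :
  simulates (init machine_of xs) (cstart C) (input_store (tnth xs)).
Proof.
split => // i; rewrite /init /= /tape_name.
case: splitP => j E; first by rewrite /= (tnth_nth [::]) -E.
rewrite nth_default ?size_tuple ?E ?leq_addr //=.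
by apply: funext => -[z|z]; rewrite /= nth_nil.
Qed.

Lemma input_size_esize (xs : a.+1.-tuple string) : input_size xs = esize (tnth xs).
Proof. by rewrite /input_size sumnE big_map big_tuple. Qed.

Lemma clock_machine_of (xs : a.+1.-tuple string) :
  halts_within (p.[input_size xs])%R (init machine_of xs).
Proof.
rewrite input_size_esize; apply: (@halts_machine_of _ (N (tnth xs)) _ _ _ (simulates_init xs)).
move=> w /minn_idPl; rewrite -size_take_min => /computes[T ex _].
by have := exec_cat (drop (N (tnth xs)) w) ex; rewrite cat_take_drop /exec => ->.
Qed.

Definition nptm_of : nptm a.+1 := NPTM clock_machine_of.

(** No other length gives a path. If [w] is too long, its prefix of length [N] suffices and the
    excess is left over. If a shorter [w] were used up by a halting run, then after padding to
    length [N] the padding would be left over, although the run uses all [N] guesses. *)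
Lemma outcome_nptm_of xs w : outcome nptm_of xs w =
  if size w == N (tnth xs) then Some (acc (ohead (F (tnth xs) w)), F (tnth xs) w) else None.
Proof.
rewrite /outcome [clock _]/= input_size_esize; set e := tnth xs.
have := run_machine_of p.[esize e]%R w (simulates_init xs); rewrite -/e.
case: eqP => [/computes [T ex hT]|sw].
  have {}ex : crun p.[esize e]%R w (cstart C, input_store e) = Some ([::], T) := ex.
  rewrite ex => -[o -> /(_ _ hT) ->].
  by rewrite (hT 0).
case E: crun => [[[|b v] T]|] // _; exfalso; apply: sw.
have [lt|le] := leqP (N e) (size w).
  have /computes[T' ex _] : size (take (N e) w) = N e by rewrite size_takel.
  have := exec_cat (drop (N e) w) ex; rewrite cat_take_drop /exec E.
  by move=> [/(congr1 size)]; rewrite size_drop /=; lia.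
have /computes[T' ex _] : size (w ++ nseq (N e - size w) true) = N e.
  by rewrite size_cat size_nseq subnKC // ltnW.
have := @exec_cat _ _ C _ _ (nseq (N e - size w) true) _ _ _ E; rewrite /= (_ : exec _ _ _ _ _ = (crun p.[esize e]%R (w ++ nseq (N e - size w) true) (cstart C, input_store e) = Some (nseq (N e - size w) true, T))) //.
rewrite (ex : crun p.[esize e]%R (w ++ nseq (N e - size w) true) (cstart C, input_store e) = _).
by move=> [/(congr1 size)]; rewrite size_nseq /=; lia.
Qed.

End Machine.

Section Conversion.
Variables (a : nat) (acc : option bool -> bool).
Local Notation V := 'I_a.+1.

(** Tape 0 holds an input and has to receive the output. Running [C0] on fresh tapes between two
    copies separates the two roles. *)
Lemma NFP_input_store N (F : (V -> string) -> string -> string) : NFP N F ->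
  exists (J aux : finType) (C : component (V + J)%type aux) (p : {poly nat}),
  forall e w, size w = N e ->
  exists2 T, exec C p.[esize e]%R w (@input_store a J aux e) ([::], T)
           & has_out (T (inl ord0)) (F e w).
Proof.
move=> [I0 [aux [C0 [inpt [out [p h]]]]]].
pose J : finType := (I0 + unit)%type; pose I : finType := (V + J)%type.
pose f (j : I0) : I := inr (inl j); pose c : I := inr (inr tt).
pose f' (i : I) := if i is inr (inl j) then Some j else None.
have fK : pcancel f f' by []. have f'K : ocancel f' f by case=> [|[]].
have gK : pcancel (id : aux -> aux) Some by [].
pose src1 (i : I) : option I := obind (fun j => omap inl (inpt j)) (f' i).
pose src2 (i : I) : option I := if i is inl v then (if v == ord0 then Some (f out) else None) else None.
have [q hq] : poly_bounded (fun n =>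
    (2 * n + 2) + (p.[n]%R + (2 * (n + p.[n]%R).+1 + 2))) by poly_bound.
exists J, aux, (cseq (copy aux src1 c) (cseq (cembed C0 f f' (id : aux -> aux) Some) (copy aux src2 c))), q.
move=> e w sw; have [T ex oT] := h e w sw; set s := F e w in oT *.
have ss : size s <= (esize e + p.[esize e]%R).+1.
  exact: exec_out_size (@bounded_tape_of _ _ _ e inpt) ex oT.
pose T0 : store I aux := @input_store a J aux e.
have src1_inl i x : src1 i = Some x -> exists v, x = inl v.
  by rewrite /src1; case: (f' i) => //= j; case: (inpt j) => //= v [<-]; exists v.
have [||||M1 [MB1 ex1 stop1]] := @exec_copy _ aux src1 c _ _ _ (esize e) w T0 erefl.
- by [].
- apply/negbTE/existsPn => i; apply/eqP => E; by have [] := src1_inl _ _ E.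
- by move=> d x /src1_inl[v ->].
- move=> d x /src1_inl[v ->]; rewrite /T0 /= obit_bits onth_default //.
  exact: size_le_esize.
set T1 := copied _ _ _ in ex1.
have hT1 j : T1 (f j) = emb (id : aux -> aux) \o tape_of aux e (inpt j).
  rewrite emb_tape_of /T1; case E: (inpt j) => [v|] /=; last first.
    by apply: funext => z; rewrite /copied /src1 /= E.
  have sj : src1 (f j) = Some (inl v) by rewrite /src1 /= E.
  apply: (copied_bits sj) => // [k _|]; first by rewrite /T0 /= obit_bits.
  by have := stop1 _ _ sj; rewrite /T0 /= obit_bits -onthNE => ->.
have := exec_embed fK f'K gK ex hT1; set T2 := overlay _ _ _ _ => ex2.
have outT2 : has_out (T2 (f out)) s by apply: has_out_emb.
have T2c : T2 c = blank aux by [].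
have [||||M2 [MB2 ex3 stop2]] := @exec_copy _ aux src2 c _ _ _ (size s) [::] T2 T2c.
- by [].
- by apply/negbTE/existsPn => -[v|//]; rewrite /src2; case: ifP.
- by move=> [v|//] x; rewrite /src2; case: ifP => // _ [<-].
- by move=> [v|//] x; rewrite /src2; case: ifP => // _ [<-]; rewrite outT2 // onth_default.
exists (copied src2 M2.+1 T2).
  apply: exec_mono (exec_seq ex1 (exec_seq ex2 ex3)).
  by apply: leq_trans (hq _); rewrite !leq_add2l leq_add2r leq_mul.
have s0 : src2 (inl ord0) = Some (f out) by rewrite /src2 eqxx.
have M2s : size s <= M2 by rewrite -onthNE -outT2 // (stop2 _ _ s0).
move=> k ks; rewrite /copied s0.
have -> : (0 <= Posz k < Posz M2.+1)%R by lia.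
by rewrite /keep_bit outT2 //; case: onth.
Qed.

Lemma NFP_nptm N (F : (V -> string) -> string -> string) : NFP N F ->
  exists M : nptm a.+1, forall xs w, outcome M xs w =
    if size w == N (tnth xs) then Some (acc (ohead (F (tnth xs) w)), F (tnth xs) w) else None.
Proof.
move=> /NFP_input_store [J [aux [C [p h]]]].
by exists (nptm_of acc h) => xs w; rewrite outcome_nptm_of.
Qed.

Lemma FP_nptm (F : (V -> string) -> string) : FP F ->
  exists2 M : nptm a.+1, deterministic M & forall xs w, outcome M xs w =
    if w is [::] then Some (acc (ohead (F (tnth xs))), F (tnth xs)) else None.
Proof.
move=> /NFP_input_store [J [aux [C [p h]]]].
have h' e w : size w = 0 ->
    exists2 T, exec (noguess C) p.[esize e]%R w (@input_store a J aux e) ([::], T)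
             & has_out (T (inl ord0)) (F e).
  by move=> sw; have [T ex oT] := h e w sw; exists T => //; case: w sw ex => // _ /exec_noguess.
exists (nptm_of acc h') => [q r|xs w]; first by rewrite /=; case: cdelta.
by rewrite outcome_nptm_of; case: w.
Qed.

End Conversion.

(** * Simulation of nondeterministic machines *)

Section Simulation.
Variables (a : nat) (M : nptm a).
Local Notation k := (extra_tapes M).
Local Notation sym := (symbol (Defs.aux M)).
(* [inr true] holds the guess string, [inr false] receives the verdict. *)
Local Notation I := ('I_k.+1 + bool)%type.

Definition sim_action (d : direction) (r : {ffun I -> sym})
    (m : state M * ('I_k.+1 -> sym * direction)) : option (state M) * (I -> sym * direction) :=
  (Some m.1, fun i => match i with
                      | inl j => m.2 j | inr b => (r i, if b then d else Stay) end).

Definition verdict_action (b : bool) (r : {ffun I -> sym}) :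
    option (state M) * (I -> sym * direction) :=
  (None, fun i => (if i is inr false then Some (inl b) else r i, Stay)).

Definition sim : component I (Defs.aux M) := @Component I (Defs.aux M) (option (state M))
  (Some (start M)) (fun q r =>
   if q is Some q' then
     match delta q' [ffun i => r (inl i)] with
     | Halt b => Step (verdict_action (b && ~~ isSome (obit (r (inr true)))) r)
     | Step m => Step (sim_action Stay r m)
     | Guess m0 m1 =>
         if obit (r (inr true)) is Some b then Step (sim_action MoveR r (if b then m1 else m0))
         else Step (verdict_action false r)
     end
   else Halt false).

Definition sim_spec n w (c : config M) (T : store I (Defs.aux M)) := exists T',
  [/\ crun (C := sim) n.+1 [::] (Some c.1, T) = Some ([::], T'),
      has_out (T' (inr false)) [:: if run n w c is Some (b, _) then b else false]
    & exists2 v, has_out (T' (inl ord0)) v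
               & forall b v', run n w c = Some (b, v') -> v' = v].

Lemma sim_verdict b n w (c : config M) T :
  cdelta (c := sim) (Some c.1) (reads T) = Step (verdict_action b (reads T)) ->
  T (inr false) = blank _ -> T (inl ord0) = abs (c.2 ord0) ->
  (if run n w c is Some (b, _) then b else false) = b ->
  (forall b v, run n w c = Some (b, v) -> v = output c) -> sim_spec n w c T.
Proof.
move=> E Tv T0 hb hv; rewrite /sim_spec hb.
exists (fun i => fstep ((verdict_action b (reads T)).2 i) (T i)); split.
- by rewrite (crun_step _ _ E); apply: (@crun_halt _ _ sim _ _ _ _ false).
- case=> [|[|j]] //= _; rewrite /fstep /shift /upd /= ?addr0 //= Tv //.
- exists (output c); last by move=> b' v /hv.
  by rewrite /= ffunE fstep_id T0; apply: has_out_bit_prefix.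
Qed.

(** [l] holds the guesses already read, which stay to the left of the head. The additional step in
    [sim_spec] writes the verdict. *)
Lemma run_sim n w l (c : config M) T : halts_within n c ->
  (forall i, T (inl i) = abs (c.2 i)) -> T (inr true) = abs (l, bits _ w) ->
  T (inr false) = blank _ -> sim_spec n w c T.
Proof.
have cur (c' : config M) T' : (forall i, T' (inl i) = abs (c'.2 i)) ->
    delta c'.1 [ffun i => reads T' (inl i)] = current c'.
  move=> h; rewrite /current; congr delta.
  by apply/ffunP => i; rewrite !ffunE h abs_read.
have gT (T' : store I (Defs.aux M)) l' w' : T' (inr true) = abs (l', bits _ w') ->
    obit (reads T' (inr true)) = ohead w'.
  by rewrite ffunE => ->; case: w'.
have act m c' T' d : (forall i, T' (inl i) = abs (c'.2 i)) ->
    forall i, fstep ((sim_action d (reads T') m).2 (inl i)) (T' (inl i)) =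
      abs ((apply_action m c').2 i).
  by move=> h i; rewrite /= h abs_step.
have halt n' c' w' l' T' b : current c' = Halt b -> (forall i, T' (inl i) = abs (c'.2 i)) ->
    T' (inr true) = abs (l', bits _ w') -> T' (inr false) = blank _ -> sim_spec n' w' c' T'.
  move=> E hT hw hv; apply: (@sim_verdict (b && nilp w')) => //.
  - by rewrite [LHS]/= cur // E (gT _ _ _ hw); case: (w').
  - by case: n' => [|m]; rewrite /= E; case: (w') => *; rewrite /= ?andbT ?andbF.
  - by move=> b' v; case: n' => [|n']; rewrite /= E; case: (w') => // -[].
elim: n w l c T => [|n IH] w l c T.
  by rewrite /=; case E: current => // _; apply: halt E.
rewrite [halts_within _ _]/=; case E: current => [b|m|m0 m1] hc hT hw hv.
- exact: halt E hT hw hv.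
- have E' : cdelta (c := sim) (Some c.1) (reads T) = Step (sim_action Stay (reads T) m).
    by rewrite /= cur // E.
  have [|||T' [h1 h2 h3]] := IH w l (apply_action m c)
    (fun i => fstep ((sim_action Stay (reads T) m).2 i) (T i)) hc.
  + exact: (act m c T Stay hT).
  + by rewrite /= ffunE fstep_id.
  + by rewrite /= ffunE fstep_id.
  exists T'; split; first by rewrite (crun_step _ _ E').
  + by rewrite /= E.
  + by rewrite /= E.
- case: w hw => [|b w] hw.
    apply: (@sim_verdict false) => //=; rewrite ?E //.
    by rewrite cur // E (gT _ _ _ hw).
  pose m := if b then m1 else m0.
  have E' : cdelta (c := sim) (Some c.1) (reads T) = Step (sim_action MoveR (reads T) m).
    by rewrite /= cur // E (gT _ _ _ hw).
  have [||||T' [h1 h2 h3]] := IH w (Some (inl b) :: l) (apply_action m c)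
    (fun i => fstep ((sim_action MoveR (reads T) m).2 i) (T i)).
  + by case/andP: hc; rewrite /m; case: (b).
  + exact: (act m c T MoveR hT).
  + by rewrite /= ffunE hw -abs_step.
  + by rewrite /= ffunE fstep_id.
  exists T'; split; first by rewrite (crun_step _ _ E').
  + by rewrite /= E.
  + by rewrite /= E.
Qed.

End Simulation.

Section SimulationFP.
Variables (a : nat) (M : nptm a).
Local Notation V := (option 'I_a).

Definition args (e : V -> string) : a.-tuple string := [tuple e (Some i) | i < a].

Lemma input_size_args e : input_size (args e) <= esize e.
Proof.
have -> : e = extend (e \o Some) (e None) by apply: funext => -[].
rewrite esize_extend /input_size sumnE big_map big_tuple.
apply: leq_trans (leq_addl _ _); apply: leq_sum => i _.
by rewrite tnth_mktuple.
Qed.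

Definition sim_inpt (i : 'I_(extra_tapes M).+1 + bool) : option V :=
  match i with
  | inl j => omap Some (insub (nat_of_ord j)) | inr b => if b then Some None else None end.

Lemma exec_sim e : exists T',
  [/\ exec (sim M) ((clock M).[input_size (args e)]%R.+1) [::]
        (fun i => tape_of _ e (sim_inpt i)) ([::], T'),
      has_out (T' (inr false)) [:: accepts M (args e) (e None)]
    & exists2 v, has_out (T' (inl ord0)) v
               & forall b v', outcome M (args e) (e None) = Some (b, v') -> v' = v].
Proof.
apply: (run_sim (l := [::]) (clockP M (args e))) => // i.
rewrite /= /init /=; case: insubP => [j ja E|ja] /=.
  congr abs; congr pair; rewrite /bits -E (nth_map j) ?size_enum_ord //; last exact: ltn_ord.
  by rewrite nth_ord_enum.
rewrite nth_default; last by rewrite size_map size_enum_ord leqNgt.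
by apply: funext => -[z|z]; rewrite /= nth_nil.
Qed.

Lemma FP_accepts : FP (fun e : V -> string => [:: accepts M (args e) (e None)]).
Proof.
have [q hq] : poly_bounded (fun n => ((clock M).[n]%R).+1) by poly_bound.
exists _, _, (sim M), sim_inpt, (inr false), q => e [|//] _.
have [T' [ex hv _]] := exec_sim e; exists T' => //.
apply: exec_mono ex; apply: leq_trans (hq _); rewrite ltnS.
exact: horner_mono (input_size_args e).
Qed.

(** The simulation leaves some bit string on tape 0 even if the guess string is no path; taking it
    as the value makes [G] total. *)
Lemma FP_output : exists2 G : (V -> string) -> string, FP G
  & forall e b v, outcome M (args e) (e None) = Some (b, v) -> v = G e.
Proof.
have /choice [G hG] e : exists v, exists T',
  [/\ exec (sim M) ((clock M).[input_size (args e)]%R.+1) [::]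
        (fun i => tape_of _ e (sim_inpt i)) ([::], T'),
      has_out (T' (inl ord0)) v
    & forall b v', outcome M (args e) (e None) = Some (b, v') -> v' = v].
  by have [T' [ex _ [v hv h]]] := exec_sim e; exists v, T'.
exists G; last by move=> e b v; have [T' [_ _ h]] := hG e; apply: h.
have [q hq] : poly_bounded (fun n => ((clock M).[n]%R).+1) by poly_bound.
exists _, _, (sim M), sim_inpt, (inl ord0), q => e [|//] _.
have [T' [ex hv _]] := hG e; exists T' => //.
apply: exec_mono ex; apply: leq_trans (hq _); rewrite ltnS.
exact: horner_mono (input_size_args e).
Qed.

End SimulationFP.

(** * Transducers and basic string functions *)

Section Transducer.
Variables (S : finType) (s0 : S).
Variable step : S -> option bool -> option bool ->
  option (S * (direction * direction) * option bool).
Local Notation ftape := (ftape void).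

Fixpoint trun (n : nat) (s : S) (tx ty : ftape) : option string :=
  match step s (obit (tx 0%R)) (obit (ty 0%R)), n with
  | None, _ => Some [::]
  | Some (s', (dx, dy), o), n'.+1 =>
      omap (cat (seq_of_opt o)) (trun n' s' (shift (disp dx) tx) (shift (disp dy) ty))
  | _, 0 => None
  end.

Definition transducer : component (option bool) void := @Component _ void S s0 (fun s r =>
  match step s (obit (r (Some true))) (obit (r (Some false))) with
  | None => Halt false
  | Some (s', (dx, dy), o) => Step (s', fun i => match i with
      | Some true => (r i, dx) | Some false => (r i, dy)
      | None => if o is Some b then (Some (inl b), MoveR) else (r i, Stay) end)
  end).

Definition tstore (tx ty : ftape) (z : string) : store (option bool) void := fun i =>
  match i with
  | Some true => tx | Some false => ty
  | None => shift (Posz (size z)) (abs ([::], bits _ z)) end.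

Lemma crun_transducer n s tx ty z w z' : trun n s tx ty = Some z' ->
  size z' <= n /\ exists tx' ty', crun (C := transducer) n w (s, tstore tx ty z) =
    Some (w, tstore tx' ty' (z ++ z')).
Proof.
elim: n s tx ty z z' => [|n IH] s tx ty z z' /=; rewrite !ffunE.
  by case: step => [[[s' []]]|] // [<-]; split => //; exists tx, ty; rewrite cats0.
case: step => [[[s' [dx dy]] o]|]; last by move=> [<-]; split => //; exists tx, ty; rewrite cats0.
rewrite /tstore; case E: (trun _ _ _ _) => [z''|] // [<-].
have [sz [tx' [ty' h]]] := IH _ _ _ (z ++ seq_of_opt o) _ E.
split; first by rewrite size_cat; case: (o) => [b|] /=; lia.
exists tx', ty'; rewrite catA -h; congr crun; congr pair; apply: funext => -[[]|] /=.
- by rewrite ffunE fstep_move.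
- by rewrite ffunE fstep_move.
- case: (o) => [b|] /=; last by rewrite ffunE fstep_id cats0.
  by rewrite cats1 fstep_shift abs_bits_rcons size_rcons /= -PoszD addn1.
Qed.

Lemma FP_transducer (op : string -> string -> string) (T : nat -> nat) : poly_bounded T ->
  (forall x y, trun (T (size x + size y)) s0 (abs ([::], bits _ x)) (abs ([::], bits _ y)) =
     Some (op x y)) ->
  FP (fun e : bool -> string => op (e true) (e false)).
Proof.
move=> bT h.
have [q hq] : poly_bounded (fun n => T n + (T n + 2)).
  by apply: poly_bounded_add => //; apply: poly_bounded_add => //; poly_bound.
exists (option bool), void, (cseq transducer (rewind _ None)), id, None, q => e [|//] _.
have se : esize e = size (e true) + size (e false) by rewrite /esize big_bool.
have [sz [tx [ty ex1]]] := crun_transducer [::] [::] (h (e true) (e false)).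
have := @exec_rewind _ void None [::] (tstore tx ty (op (e true) (e false))) (op (e true) (e false)).
set T1 := set_tape _ _ _ => ex2.
have E : T1 = tstore tx ty (op (e true) (e false)) by apply: funext => -[[]|].
rewrite {}E {T1} in ex2; exists (set_tape None (tstore tx ty (op (e true) (e false)))
  (abs ([::], bits _ (op (e true) (e false))))); last exact: has_out_abs.
have E : (fun i => tape_of void e (id i)) =
    tstore (abs ([::], bits _ (e true))) (abs ([::], bits _ (e false))) [::].
  apply: funext => -[[]|] //=; rewrite shift0.
  by apply: funext => -[z|z]; rewrite /= nth_nil.
have lq : T (esize e) + (size (op (e true) (e false)) + 2) <= q.[esize e]%R.
  by apply: leq_trans (hq _); rewrite leq_add2l leq_add2r se.
have := exec_seq (C1 := transducer) ex1 ex2; rewrite -E -se.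
exact: exec_mono.
Qed.

Definition reads_as (t : ftape) (x : string) := forall k, obit (t (Posz k)) = onth x k.

Lemma reads_as_abs x : reads_as (abs ([::], bits _ x)) x.
Proof. by move=> k; rewrite /= obit_bits. Qed.

Lemma reads_as0 t x : reads_as t x -> obit (t 0%R) = ohead x.
Proof. by move=> h; rewrite (h 0); case: x {h}. Qed.

Lemma reads_as_behead t x : reads_as t x -> reads_as (shift 1%R t) (behead x).
Proof.
move=> h k; rewrite /shift; have -> : (Posz k + 1)%R = Posz k.+1 by lia.
by rewrite h; case: x {h} => [|a x] //; case: k.
Qed.

End Transducer.

Lemma shift_behead t b x : reads_as t (b :: x) -> reads_as (shift (disp MoveR) t) x.
Proof. exact: reads_as_behead. Qed.

Lemma reads_as_stay t x : reads_as t x -> reads_as (shift (disp Stay) t) x.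
Proof. by rewrite /= shift0. Qed.

Lemma FP_op2 (V : finType) (op : string -> string -> string) F G :
  FP (fun e : bool -> string => op (e true) (e false)) -> FP F -> FP G ->
  FP (fun e : V -> string => op (F e) (G e)).
Proof.
move=> hop hF hG.
by apply: (FP_comp (F := fun b : bool => if b then F else G)) hop => -[].
Qed.

Section BasicFunctions.
Variable V : finType.
Implicit Types F G : (V -> string) -> string.

Lemma FP_proj (v : V) : FP (fun e => e v).
Proof.
exists unit, void, (@Component unit void unit tt (fun _ _ => Halt false)), (fun=> Some v), tt, 0%R.
move=> e [|//] _; exists (fun i => tape_of _ e (Some v)); first by rewrite /exec horner0.
exact: has_out_abs.
Qed.

Lemma FP_nil : FP (fun e : V -> string => [::]).
Proof.
exists unit, void, (@Component unit void unit tt (fun _ _ => Halt false)), (fun=> None), tt, 0%R.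
move=> e [|//] _; exists (fun i => blank _); first by rewrite /exec horner0.
by case.
Qed.

End BasicFunctions.

Section Operations.
Variable V : finType.
Implicit Types F G : (V -> string) -> string.

(** Stopping costs no step, so [size x + size y] steps suffice if each of them reads a symbol; [c]
    pays for the steps that read none. *)
Lemma FP_oneway (S : finType) (s0 : S) step (op : string -> string -> string) c :
  (forall n x y tx ty, reads_as tx x -> reads_as ty y -> size x + size y <= n ->
     trun step (n + c) s0 tx ty = Some (op x y)) ->
  forall F G, FP F -> FP G -> FP (fun e => op (F e) (G e)).
Proof.
move=> h F G; apply: FP_op2; apply: (@FP_transducer _ s0 step _ (fun n => n + c)).
  by poly_bound.
by move=> x y; apply: h => //; exact: reads_as_abs.
Qed.

Ltac onestep hx hy := rewrite /= ?(reads_as0 hx) ?(reads_as0 hy) /=.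
Ltac read_step := by first
  [ simpl in *; lia | apply: shift_behead; eassumption | apply: reads_as_stay; eassumption
  | apply: (@reads_as_behead _ [::]); eassumption ].

Lemma FP_cat F G : FP F -> FP G -> FP (fun e => F e ++ G e).
Proof.
apply: (@FP_oneway unit tt (fun _ a b =>
  if isSome a then Some (tt, (MoveR, Stay), a)
  else if isSome b then Some (tt, (Stay, MoveR), b) else None) _ 0) => n.
rewrite addn0; elim: n => [|n IH] [|a x] [|b y] // tx ty hx hy hn; onestep hx hy => //.
- by rewrite (IH [::] y) //; read_step.
- by rewrite (IH x [::]) //; read_step.
- by rewrite (IH x (b :: y)) //; read_step.
Qed.

Lemma FP_drop F G : FP F -> FP G -> FP (fun e => drop (size (F e)) (G e)).
Proof.
apply: (@FP_oneway unit tt (fun _ a b => if isSome b then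
    Some (tt, (MoveR, MoveR), if isSome a then None else b) else None)
  (fun x y => drop (size x) y) 0) => n.
rewrite addn0; elim: n => [|n IH] [|a x] [|b y] // tx ty hx hy hn; onestep hx hy => //.
- by rewrite (IH [::] y) ?drop0 //; read_step.
- by rewrite (IH x y) //; read_step.
Qed.

Lemma FP_take F G : FP F -> FP G -> FP (fun e => take (size (F e)) (G e)).
Proof.
apply: (@FP_oneway unit tt (fun _ a b => if isSome a then Some (tt, (MoveR, MoveR), b) else None)
  (fun x y => take (size x) y) 0) => n.
rewrite addn0; elim: n => [|n IH] [|a x] [|b y] // tx ty hx hy hn; onestep hx hy => //.
- by rewrite (IH x [::]) //; read_step.
- by rewrite (IH x y) //; read_step.
Qed.

Lemma FP_map (f : bool -> bool) F : FP F -> FP (fun e => map f (F e)).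
Proof.
move=> hF; apply: (@FP_oneway unit tt (fun _ a _ =>
  if isSome a then Some (tt, (MoveR, Stay), omap f a) else None)
  (fun x y => map f x) 0) (hF) (hF) => n.
rewrite addn0; elim: n => [|n IH] [|a x] y // tx ty hx hy hn; onestep hx hy => //.
by rewrite (IH x y) //; read_step.
Qed.

Definition select (c : string) (y : string) := if ohead c == Some true then y else [::].

Lemma FP_select F G : FP F -> FP G -> FP (fun e => select (F e) (G e)).
Proof.
apply: (@FP_oneway bool false (fun s a b =>
  if s then (if isSome b then Some (true, (Stay, MoveR), b) else None)
  else if a == Some true then Some (true, (Stay, Stay), None) else None) _ 1) => n.
have H x y tx ty : reads_as tx x -> reads_as ty y -> size y <= n ->
    trun (fun s a b => if s then (if isSome b then Some (true, (Stay, MoveR), b) else None)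
      else if a == Some true then Some (true, (Stay, Stay), None) else None) n true tx ty = Some y.
  elim: n y tx ty => [|n IH] [|b y] // tx ty hx hy hn; onestep hx hy => //.
  by rewrite (IH y) //; read_step.
move=> x y tx ty hx hy hn; rewrite addn1; onestep hx hy; rewrite /select.
case: eqP => // _; rewrite (H x y) //; first exact: reads_as_stay; first exact: reads_as_stay.
lia.
Qed.

Lemma FP_cons b F : FP F -> FP (fun e => b :: F e).
Proof.
move=> hF; apply: (@FP_oneway bool true (fun s a _ =>
  if s then Some (false, (Stay, Stay), Some b)
  else if isSome a then Some (false, (MoveR, Stay), a) else None)
  (fun x y => b :: x) 1) (hF) (hF) => n.
have H x y tx ty : reads_as tx x -> reads_as ty y -> size x <= n ->
    trun (fun s a _ => if s then Some (false, (Stay, Stay), Some b)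
      else if isSome a then Some (false, (MoveR, Stay), a) else None) n false tx ty = Some x.
  elim: n x tx ty => [|n IH] [|a x] // tx ty hx hy hn; onestep hx hy => //.
  by rewrite (IH x) //; read_step.
move=> x y tx ty hx hy hn; rewrite addn1; onestep hx hy.
rewrite (H x y) //; first exact: reads_as_stay; first exact: reads_as_stay.
lia.
Qed.

(** The decoding of [pad]: the leading zeros and the first one are removed. *)
Fixpoint strip (w : string) : string :=
  if w is b :: w' then (if b then w' else strip w') else [::].

Lemma FP_strip F : FP F -> FP (fun e => strip (F e)).
Proof.
move=> hF; pose step (s : bool) (a _ : option bool) :=
  if a is Some b then Some (s || b, (MoveR, Stay), if s then a else None) else None.
apply: (@FP_oneway bool false step (fun x y => strip x) 0) (hF) (hF) => n.
rewrite addn0.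
have H m x y tx ty : reads_as tx x -> reads_as ty y -> size x <= m ->
    trun step m true tx ty = Some x.
  elim: m x tx ty => [|m IH] [|a x] // tx ty hx hy hn; onestep hx hy => //.
  by rewrite (IH x) //; read_step.
elim: n => [|n IH] [|a x] y // tx ty hx hy hn; onestep hx hy => //.
case: a hn hx => hn hx /=; first by rewrite (H _ x y) //; read_step.
by rewrite (IH x y) //; read_step.
Qed.

Section Automaton.
Variables (S : finType) (s0 : S) (tr : S -> option bool -> option bool -> S) (fin : S -> bool).

Fixpoint scan (s : S) (x y : string) : S :=
  if x is a :: x' then scan (tr s (Some a) (ohead y)) x' (behead y)
  else foldl (fun s b => tr s None (Some b)) s y.

Lemma FP_scan F G : FP F -> FP G -> FP (fun e => [:: fin (scan s0 (F e) (G e))]).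
Proof.
pose step (s : option S) a b := if s is Some s' then
   (if isSome a || isSome b then Some (Some (tr s' a b), (MoveR, MoveR), None)
    else Some (None, (Stay, Stay), Some (fin s'))) else None.
apply: (@FP_oneway _ (Some s0) step (fun x y => [:: fin (scan s0 x y)]) 1) => n.
move: s0; elim: n => [|n IH] s [|a x] [|b y] // tx ty hx hy hn; rewrite ?addSn; onestep hx hy => //.
- by case: n {IH hn}.
- by rewrite (IH _ [::] y) //; read_step.
- by rewrite (IH _ x [::]) //; read_step.
- by rewrite (IH _ x y) //; read_step.
Qed.

End Automaton.

(* The head on [y] sweeps back and forth, once for each symbol of [x]. *)
Definition mul_step (s : option bool) (a b : option bool) :
    option (option bool * (direction * direction) * option bool) :=
  match s with
  | None => if isSome a then Some (Some true, (MoveR, Stay), None) else None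
  | Some rgt =>
      if isSome b then Some (s, (Stay, if rgt then MoveR else MoveL), Some true)
      else if isSome a then
        Some (Some (~~ rgt), (MoveR, if rgt then MoveL else MoveR), None)
      else None
  end.

Lemma trun_mul_right y n tx j : j <= size y ->
  trun mul_step (j + n) (Some true) tx (shift (Posz (size y - j)) (abs ([::], bits _ y))) =
  omap (cat (nseq j true))
    (trun mul_step n (Some true) tx (shift (Posz (size y)) (abs ([::], bits _ y)))).
Proof.
elim: j => [|j IH] jy; first by rewrite subn0; case: trun.
rewrite addSn [LHS]/= shift_at0 /= obit_bits onthTE.
have -> : size y - j.+1 < size y by lia.
rewrite shift0; have -> : shift 1%R (shift (Posz (size y - j.+1)) (abs ([::], bits void y))) =
    shift (Posz (size y - j)) (abs ([::], bits void y)).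
  apply: funext => z; rewrite /shift; congr abs; lia.
by rewrite IH 1?ltnW //; case: trun.
Qed.

Lemma trun_mul_left y n tx j : j <= size y ->
  trun mul_step (j + n) (Some false) tx (shift (Posz j - 1)%R (abs ([::], bits _ y))) =
  omap (cat (nseq j true))
    (trun mul_step n (Some false) tx (shift (-1)%R (abs ([::], bits _ y)))).
Proof.
elim: j => [|j IH] jy; first by rewrite sub0r; case: trun.
rewrite addSn [LHS]/= shift_at0.
have -> : (Posz j.+1 - 1)%R = Posz j by lia.
rewrite /= obit_bits onthTE jy shift0.
have -> : shift (-1)%R (shift (Posz j) (abs ([::], bits void y))) =
    shift (Posz j - 1)%R (abs ([::], bits void y)).
  apply: funext => z; rewrite /shift; congr abs; lia.
by rewrite IH 1?ltnW //; case: trun.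
Qed.

(** The sweep about to begin adds to one sweep for each remaining symbol of [x], hence
    [(size x).+1]. Its direction tells at which end of [y] the head starts. *)
Lemma trun_mul (rgt : bool) x y tx n (p := if rgt then 0%R else (Posz (size y) - 1)%R) :
  reads_as tx x -> (size x).+1 * (size y).+1 <= n ->
  trun mul_step n (Some rgt) tx (shift p (abs ([::], bits _ y))) =
  Some (nseq ((size x).+1 * size y) true).
Proof.
elim: x rgt tx n @p => [|a x IH] rgt tx n /= hx hn.
all: have -> : n = size y + (n - size y).-1.+1 by lia.
all: set m := (n - size y).-1.
all: have E : trun mul_step (size y + m.+1) (Some rgt) tx
    (shift (if rgt then 0%R else (Posz (size y) - 1)%R) (abs ([::], bits _ y))) =
  omap (cat (nseq (size y) true)) (trun mul_step m.+1 (Some rgt) tx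
    (shift (if rgt then Posz (size y) else (-1)%R) (abs ([::], bits _ y)))).
1,3: by case: rgt; [rewrite -trun_mul_right // subnn|rewrite trun_mul_left].
all: rewrite {}E [trun _ _.+1 _ _ _]/= shift_at0 (reads_as0 hx).
all: have -> : obit (abs ([::], bits void y) (if rgt then Posz (size y) else (-1)%R)) = None
  by case: rgt; rewrite /= ?obit_bits ?onth_default ?nth_nil.
  by rewrite /= cats0 mul1n.
rewrite /=.
have := IH (~~ rgt) (shift 1%R tx) m (reads_as_behead hx).
have -> : (if ~~ rgt then 0%R else (Posz (size y) - 1)%R) =
   ((if rgt then Posz (size y) else (-1)) + disp (if rgt then MoveL else MoveR))%R.
  by case: rgt => /=; lia.
have -> : forall q r (f : ftape void), shift r (shift q f) = shift (q + r)%R f.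
  by move=> q r f; apply: funext => z; rewrite /shift; congr f; lia.
move=> -> /=; last by rewrite /m; lia.
by rewrite -nseqD; congr Some; congr nseq; lia.
Qed.

Lemma FP_mul F G : FP F -> FP G -> FP (fun e => nseq (size (F e) * size (G e)) true).
Proof.
apply: (@FP_op2 _ (fun x y => nseq (size x * size y) true)).
apply: (@FP_transducer (option bool) None mul_step (fun x y => nseq (size x * size y) true)
  (fun n => (n.+1 * n.+1).+1)); first by poly_bound.
move=> x y; have := leqnn ((size x + size y).+1 * (size x + size y).+1).
move: {-1}(_ * _)%N => m hm.
rewrite /= (reads_as0 (reads_as_abs x)); case: x hm => [|a x] hm //.
rewrite /= shift0 -[abs ([::], bits _ y)]shift0.
rewrite (@trun_mul true x y) ?cat0s //; first exact: (@reads_as_behead _ (a :: x) (reads_as_abs (a :: x))).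
by apply: leq_trans hm; apply: leq_mul => /=; lia.
Qed.

End Operations.

(** * Binary values of strings *)

Definition value (s : string) : nat := foldl (fun v (b : bool) => v.*2 + b) 0 s.

Lemma value_cat s t : value (s ++ t) = value s * 2 ^ size t + value t.
Proof.
rewrite /value foldl_cat; move: (foldl _ 0 s) => v.
elim/last_ind: t => [|t b IH]; first by rewrite /= expn0 muln1 addn0.
by rewrite !foldl_rcons size_rcons IH expnS; lia.
Qed.

Lemma value_cons b s : value (b :: s) = b * 2 ^ size s + value s.
Proof. by rewrite -cat1s value_cat /value /= add0n. Qed.

Lemma value_lt s : value s < 2 ^ size s.
Proof. by elim: s => [|b s IH] //=; rewrite value_cons expnS; case: b; lia. Qed.

Lemma value_inj s t : size s = size t -> value s = value t -> s = t.
Proof.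
elim: s t => [|a s IH] [|b t] //= [st]; rewrite !value_cons st.
have := value_lt s; have := value_lt t; rewrite st => ht hs h.
have ab : a = b by move: h; case: a; case: b => //=; lia.
by rewrite ab (IH t) //; move: h; rewrite ab; lia.
Qed.

Lemma value_nseq0 n : value (nseq n false) = 0.
Proof. by elim: n => [|n IH] //=; rewrite value_cons IH mul0n. Qed.

Lemma value_nseq1 n : value (nseq n true) = (2 ^ n).-1.
Proof.
elim: n => [|n IH] //=; rewrite value_cons IH size_nseq expnS.
by have := expn_gt0 2 n; lia.
Qed.

Lemma value_surj n k : k < 2 ^ n -> exists2 s, size s = n & value s = k.
Proof.
elim: n k => [|n IH] k; first by case: k => // _; exists [::].
move=> hk; have [lt|le] := ltnP k (2 ^ n).
  by have [s sn sk] := IH k lt; exists (false :: s); rewrite /= ?sn // value_cons sk.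
have [|s sn sk] := IH (k - 2 ^ n); first by move: hk; rewrite expnS; lia.
by exists (true :: s); rewrite /= ?sn // value_cons sn sk; lia.
Qed.

Lemma lex_le_value y z : size y = size z -> lex_le y z <-> value y <= value z.
Proof.
rewrite /lex_le; elim: y z => [|a y IH] [|b z] //= [yz].
rewrite Order.SeqLexiOrder.lexi_cons !value_cons yz.
have := value_lt y; have := value_lt z; rewrite yz; have {IH} := IH z yz.
move=> IH hz hy; case: a; case: b; rewrite /= ?mul1n ?mul0n ?add0n ?leq_add2l //.
- by split=> //; lia.
- by split=> // _; lia.
Qed.

Lemma lex_lt_value y z : size y = size z -> lex_lt y z <-> value y < value z.
Proof.
move=> yz; rewrite /lex_lt Order.TotalTheory.ltNge ltnNge.
have := @lex_le_value z y (esym yz); rewrite /lex_le => -[h1 h2].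
by split=> /negP h; apply/negP => h'; apply: h; [apply: h2|apply: h1].
Qed.

Lemma lex_succ_value y z : lex_succ y z <-> size y = size z /\ value z = (value y).+1.
Proof.
split=> [[yz /(lex_lt_value yz) lt h]|[yz h]].
  split=> //; apply/eqP; rewrite eqn_leq lt andbT leqNgt; apply/negP => lt'.
  have [|w sw vw] := @value_surj (size y) (value y).+1.
    by apply: leq_trans lt' _; rewrite ltnW // yz value_lt.
  by apply: (h w sw); rewrite !lex_lt_value ?sw -?yz ?vw.
split=> //; first by apply/lex_lt_value; rewrite ?h.
move=> w sw; rewrite !lex_lt_value ?sw -?yz //; lia.
Qed.

Definition lexs y z := (size y == size z) && (value z == (value y).+1).

(** * Polynomial-time predicates *)

Definition PP (V : finType) (P : (V -> string) -> bool) := FP (fun e => [:: P e]).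

Section Predicates.
Variable V : finType.
Implicit Types (F G : (V -> string) -> string) (P Q : (V -> string) -> bool).

Lemma PP_const b : PP (fun e : V -> string => b).
Proof. exact: FP_cons (FP_nil V). Qed.

Lemma PP_not P : PP P -> PP (fun e => ~~ P e).
Proof. by move=> /(FP_map negb). Qed.

Lemma FP_if P F G : PP P -> FP F -> FP G -> FP (fun e => if P e then F e else G e).
Proof.
move=> hP hF hG; have := FP_cat (FP_select hP hF) (FP_select (PP_not hP) hG).
by apply: FP_ext => e; rewrite /select /=; case: (P e); rewrite ?cats0.
Qed.

Lemma PP_and P Q : PP P -> PP Q -> PP (fun e => P e && Q e).
Proof.
move=> hP hQ; have := FP_if hP hQ (PP_const false).
by apply: FP_ext => e; case: (P e).
Qed.

Lemma PP_or P Q : PP P -> PP Q -> PP (fun e => P e || Q e).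
Proof.
move=> hP hQ; have := FP_if hP (PP_const true) hQ.
by apply: FP_ext => e; case: (P e).
Qed.

Lemma PP_if P Q Q' : PP P -> PP Q -> PP Q' -> PP (fun e => if P e then Q e else Q' e).
Proof.
move=> hP hQ hQ'; have := FP_if hP hQ hQ'.
by apply: FP_ext => e; case: (P e).
Qed.

Lemma PP_eq F G : FP F -> FP G -> PP (fun e => F e == G e).
Proof.
move=> hF hG; have := FP_scan true (fun s a b => s && (a == b)) id hF hG.
apply: FP_ext => e; congr [:: _]; move: (F e) (G e) => x y.
suff H s : scan (fun s a b => s && (a == b)) s x y = s && (x == y) by rewrite H.
elim: x y s => [|a x IH] [|b y] s /=; rewrite ?andbT ?andbF //.
- by case: s; elim: y.
- by rewrite IH eqseq_cons andbA.
Qed.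

(** Consecutive strings have the form [z 0 1^k] and [z 1 0^k]. In state [None] the prefixes still
    agree, in state [Some true] the tails are being read, and [Some false] is failure. *)
Definition succ_tr (s : option bool) (a b : option bool) : option bool :=
  match s, a, b with
  | None, _, _ => if a == b then None
                  else Some ((a == Some false) && (b == Some true))
  | Some true, Some true, Some false => Some true
  | _, _, _ => Some false
  end.

Lemma PP_lexs F G : FP F -> FP G -> PP (fun e => lexs (F e) (G e)).
Proof.
move=> hF hG; have := FP_scan None succ_tr (fun s => s == Some true) hF hG.
apply: FP_ext => e; congr [:: _]; move: (F e) (G e) => x y.
have neq (a b : bool) : (Some a == Some b) = eqb a b by [].
have foldF z : foldl (fun s b => succ_tr s None (Some b)) (Some false) z = Some false.
  by elim: z.
have scanF z w : scan succ_tr (Some false) z w = Some false.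
  by elim: z w => [|a z IH] w //=.
(* As [value z < 2 ^ size z], the equation says that [z] consists of ones and [w] of zeros. *)
have scanT z w : (scan succ_tr (Some true) z w == Some true) =
    (size z == size w) && ((value z).+1 == 2 ^ size z + value w).
  elim: z w => [|a z IH] [|b w] //=; first by rewrite foldF.
    by case: a; rewrite scanF.
  rewrite !value_cons eqSS expnS; have := value_lt z; have := value_lt w.
  move: (IH w); case: (eqVneq (size z) (size w)) => [<-|_] /= IH' hw hz;
    case: a; case: b; rewrite ?scanF ?IH' ?neq //=; lia.
rewrite /lexs; elim: x y {F G hF hG} => [|a x IH] [|b y] //=.
- by rewrite foldF.
- by case: a; rewrite scanF.
rewrite !value_cons eqSS; have := value_lt x; have := value_lt y.
move: (IH y) (scanT x y); case: (eqVneq (size x) (size y)) => [<-|_] /= IH' ST hy hx;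
  case: a; case: b; rewrite ?neq /= ?IH' ?ST ?scanF ?neq //=; lia.
Qed.

Definition less_tr (s : option bool) (a b : option bool) : option bool :=
  if s is Some _ then s else if a == b then None else Some (b == Some true).

Definition less x y := scan less_tr None x y == Some true.

Lemma lessE x y : size x = size y -> less x y = (value x < value y).
Proof.
have neq (a b : bool) : (Some a == Some b) = eqb a b by [].
have scanS v z w : scan less_tr (Some v) z w = Some v.
  by elim: z w => [|a z IH] w /=; [elim: w|apply: IH].
rewrite /less; elim: x y => [|a x IH] [|b y] //= [xy]; rewrite !value_cons xy.
have := value_lt x; have := value_lt y; have := IH y xy; rewrite xy.
by move=> IH' hy hx; case: a; case: b; rewrite ?neq /= ?scanS ?IH' ?neq //=; lia.
Qed.

Lemma PP_less F G : FP F -> FP G -> PP (fun e => less (F e) (G e)).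
Proof. exact: (FP_scan None less_tr (fun s => s == Some true)). Qed.

Lemma FP_nseq_true (c : nat) : FP (fun e : V -> string => nseq c true).
Proof. by elim: c => [|c IH]; [exact: FP_nil|exact: FP_cons IH]. Qed.

(** Horner's scheme on unary numbers, with [FP_mul] as multiplication. *)
Lemma FP_ones (p : {poly nat}) F : FP F -> FP (fun e => nseq p.[size (F e)]%R true).
Proof.
move=> hF; elim/poly_ind: p => [|p c IH].
  by apply: FP_ext (FP_nil V) => e; rewrite horner0.
have := FP_cat (FP_mul IH hF) (FP_nseq_true c).
by apply: FP_ext => e; rewrite size_nseq -nseqD hornerMXaddC.
Qed.

Lemma FP_nseq b (p : {poly nat}) F : FP F -> FP (fun e => nseq p.[size (F e)]%R b).
Proof.
move=> /(FP_ones p)/(FP_map (fun=> b)).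
by apply: FP_ext => e; rewrite map_nseq.
Qed.

Lemma FP_takep (p : {poly nat}) F G : FP F -> FP G ->
  FP (fun e => take p.[size (F e)]%R (G e)).
Proof.
move=> /(FP_ones p) h /(FP_take h).
by apply: FP_ext => e; rewrite size_nseq.
Qed.

Lemma FP_dropp (p : {poly nat}) F G : FP F -> FP G ->
  FP (fun e => drop p.[size (F e)]%R (G e)).
Proof.
move=> /(FP_ones p) h /(FP_drop h).
by apply: FP_ext => e; rewrite size_nseq.
Qed.

End Predicates.

(** * The complexity classes in terms of polynomial-time functions *)

Definition FP1 (f : string -> string) := FP (fun e : unit -> string => f (e tt)).

Definition FP2 (f : string -> string -> string) :=
  FP (fun e : bool -> string => f (e true) (e false)).

Definition FP3 (f : string -> string -> string -> string) :=
  FP (fun e : 'I_3 -> string => f (e (inord 0)) (e (inord 1)) (e (inord 2))).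

Definition PP2 (R : string -> string -> bool) := FP2 (fun x y => [:: R x y]).

Definition PP3 (R : string -> string -> string -> bool) := FP3 (fun x y z => [:: R x y z]).

Section Substitution.
Variable V : finType.
Implicit Types F G H : (V -> string) -> string.

Lemma FP1_comp f F : FP1 f -> FP F -> FP (fun e => f (F e)).
Proof. by move=> hf hF; apply: (FP_comp (F := fun=> F)) hf => -[]. Qed.

Lemma FP2_comp f F G : FP2 f -> FP F -> FP G -> FP (fun e => f (F e) (G e)).
Proof. exact: FP_op2. Qed.

Lemma FP3_comp f F G H : FP3 f -> FP F -> FP G -> FP H ->
  FP (fun e => f (F e) (G e) (H e)).
Proof.
move=> hf hF hG hH.
have h (i : 'I_3) : FP (nth F [:: F; G; H] i) by case: i => -[|[|[|i]]].
by apply: FP_ext (FP_comp h hf) => e; rewrite !inordK.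
Qed.

Lemma PP2_comp R F G : PP2 R -> FP F -> FP G -> PP (fun e => R (F e) (G e)).
Proof. exact: (@FP2_comp (fun x y => [:: R x y])). Qed.

Lemma PP3_comp R F G H : PP3 R -> FP F -> FP G -> FP H ->
  PP (fun e => R (F e) (G e) (H e)).
Proof. exact: (@FP3_comp (fun x y z => [:: R x y z])). Qed.

Lemma FP_zeros F : FP F -> FP (fun e => nseq (size (F e)) false).
Proof.
by move=> /(FP_map (fun=> false)); apply: FP_ext => e; elim: (F e) => //= _ s ->.
Qed.

End Substitution.

Lemma FP_nptm1 f : FP1 f -> exists2 M : nptm 1, deterministic M
  & forall x w, outcome M [tuple x] w = if w is [::] then Some (true, f x) else None.
Proof.
move=> hf.
have /(FP_nptm predT) [M dM hM] := FP1_comp hf (FP_proj (ord0 : 'I_1)).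
by exists M => // x w; rewrite hM (tnth_nth [::]).
Qed.

Lemma FP1_FPt f : FP1 f -> FPt f.
Proof. by move=> /FP_nptm1[M dM h]; exists M; split => // x; rewrite h. Qed.

Lemma args1 (e : option 'I_1 -> string) : args e = [tuple e (Some ord0)].
Proof. by apply: eq_from_tnth => i; rewrite tnth_mktuple (tnth_nth [::]) !ord1. Qed.

Lemma FP2_output (M : nptm 1) : exists2 G, FP2 G
  & forall x w b v, outcome M [tuple x] w = Some (b, v) -> v = G x w.
Proof.
have [G hG h] := FP_output M.
exists (fun x w => G (fun o => if o is Some _ then x else w)).
  apply: FP_ext (FP_reindex (fun o : option 'I_1 => Some (isSome o)) hG) => e.
  by congr G; apply: funext => -[].
by move=> x w b v hv; apply: (h _ b); rewrite args1.
Qed.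

Lemma FPt_FP1 f : FPt f -> FP1 f.
Proof.
move=> [M [_ hM]]; have [G hG h] := FP2_output M.
apply: FP_ext (FP2_comp hG (FP_proj tt) (FP_nil _)) => e.
by have := hM (e tt); case E: outcome => [[b v]|] //= [<-]; rewrite (h _ _ _ _ E).
Qed.

Lemma PP2_accepts (M : nptm 1) : PP2 (fun x w => accepts M [tuple x] w).
Proof.
apply: FP_ext (FP_reindex (fun o : option 'I_1 => Some (isSome o)) (FP_accepts M)) => e.
by rewrite args1.
Qed.

Lemma polytime_predicate3_PP3 r : polytime_predicate3 r ->
  exists2 R, PP3 R & forall x y z, r x y z <-> R x y z.
Proof.
move=> [M [_ hM]]; exists (fun x y z => accepts M [tuple x; y; z] [::]) => //.
apply: FP_ext (FP_reindex id (FP_accepts M)) => e.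
congr [:: accepts M _ _]; apply: eq_from_tnth => i; rewrite tnth_mktuple (tnth_nth [::]).
by case: i => -[|[|[|i]]] //= hi; congr e; apply: val_inj; rewrite /= inordK.
Qed.

Lemma PP3_polytime_predicate3 R : PP3 R -> polytime_predicate3 (fun x y z => R x y z).
Proof.
move=> /(FP_nptm (pred1 (Some true))) [M dM hM]; exists M; split => // x y z.
rewrite /accepts hM !(tnth_nth [::]) /= !inordK //=.
by case: (R x y z).
Qed.

(** All [p.[size x]] bits are guessed before [R] is evaluated without further guesses, so the paths
    are exactly the strings of this length. *)
Lemma balanced_nptm (p : {poly nat}) R : PP2 R ->
  exists2 M : nptm 1, balanced p M
  & forall x w, accepts M [tuple x] w = (size w == p.[size x]%R) && R x w.
Proof.
move=> hR; pose x0 (e : 'I_1 -> string) := e ord0.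
have hP : FP (fun e => nseq p.[size (x0 e)]%R true) by apply: FP_ones; apply: FP_proj.
have hR' := PP2_comp hR (FP_proj (Some (ord0 : 'I_1))) (FP_proj None).
have /(NFP_nptm (pred1 (Some true))) [M hM] := NFP_let (NFP_guess hP) hR'.
have out x w : outcome M [tuple x] w = if size w == p.[size x]%R then Some (R x w, [:: R x w]) else None.
  by rewrite hM size_nseq /x0 (tnth_nth [::]) /=; case: ifP => // _; case: (R x w).
exists M => x w; last by rewrite /accepts out; case: eqP => //=.
by rewrite /is_path out /words /=; case: eqP; split.
Qed.

(** * UP in terms of unique witnesses of fixed length *)

Definition unique_verifier (L : string -> Prop) (p : {poly nat}) (R : string -> string -> bool) :=
  forall x, (L x <-> exists2 w, size w = p.[size x]%R & R x w) /\
    forall v w, size v = p.[size x]%R -> size w = p.[size x]%R -> R x v -> R x w -> v = w.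

Lemma unique_verifier_UP L p R : PP2 R -> unique_verifier L p R -> UP L.
Proof.
move=> /(balanced_nptm p) [M _ hM] hV; exists M; split => x.
  move=> v w; rewrite !hM => /andP[/eqP sv Rv] /andP[/eqP sw Rw].
  by have [_] := hV x; apply.
have [[h1 h2] _] := hV x; split => [/h1[w sw Rw]|[w]].
  by exists w; rewrite hM sw eqxx.
by rewrite hM => /andP[/eqP sw Rw]; apply: h2; exists w.
Qed.

Lemma size_path (M : nptm 1) x w o :
  outcome M [tuple x] w = Some o -> size w <= (clock M).[size x]%R.
Proof.
rewrite /outcome /input_size /= addn0.
move: (init _ _) (_.[_])%R => c n.
elim: n w c => [|n IH] w c /=; case: current => [b|m|m0 m1] //; case: w => //= [b' w].
- by move=> /IH; apply: leqW.
- exact: IH.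
Qed.

Definition pad (n : nat) (w : string) := nseq (n - size w) false ++ true :: w.

Lemma size_pad n w : size w <= n -> size (pad n w) = n.+1.
Proof. by move=> h; rewrite size_cat size_nseq /= addnS subnK. Qed.

Lemma strip_pad n w : strip (pad n w) = w.
Proof. by rewrite /pad; elim: (n - size w). Qed.

(** [strip] maps strings of zeros to the empty string too. They are excluded, as the empty path
    would otherwise have a second code. *)
Definition padded (w : string) := w != nseq (size w) false.

Lemma padded_pad n w : padded (pad n w).
Proof.
apply/eqP => E; have : true \in pad n w by rewrite mem_cat inE eqxx orbT.
by rewrite E mem_nseq andbF.
Qed.

Lemma pad_strip n w : size w = n.+1 -> padded w -> pad n (strip w) = w.
Proof.
move=> sw pw; have [k E] : exists k, w = nseq k false ++ true :: strip w.
  elim: w pw {sw} => [|[] w IH] //=; first by exists 0.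
  by rewrite /padded /= eqseq_cons eqxx => /IH [k E]; exists k.+1; rewrite {1}E.
move: sw; rewrite {1}E size_cat size_nseq /= addnS => -[sw].
by rewrite /pad -sw addnK -E.
Qed.

(* The paths of a machine have various lengths; a path [w] is encoded by the
   string [0^k 1 w] of fixed length. *)
Section EncodedPaths.
Variable M : nptm 1.

Definition path_length : {poly nat} := (clock M + 1)%R.

Definition accepts_padded x w := padded w && accepts M [tuple x] (strip w).

Lemma size_path_length n : path_length.[n]%R = ((clock M).[n]%R).+1.
Proof. by rewrite /path_length hornerD hornerC; exact: addn1. Qed.

Lemma PP2_accepts_padded : PP2 accepts_padded.
Proof.
apply: PP_and.
  apply/PP_not/PP_eq; first exact: FP_proj.
  exact: FP_zeros (FP_proj false).
exact: PP2_comp (PP2_accepts M) (FP_proj true) (FP_strip (FP_proj false)).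
Qed.

Lemma accepts_pad x w : accepts M [tuple x] w ->
  size (pad (clock M).[size x]%R w) = path_length.[size x]%R /\
  accepts_padded x (pad (clock M).[size x]%R w).
Proof.
move=> h; rewrite size_path_length /accepts_padded padded_pad strip_pad; split => //.
by apply: size_pad; move: h; rewrite /accepts; case E: outcome => [o|] // _; apply: size_path E.
Qed.

Lemma accepts_padded_inj x v w : at_most_one_accepting M [tuple x] ->
  size v = path_length.[size x]%R -> size w = path_length.[size x]%R ->
  accepts_padded x v -> accepts_padded x w -> v = w.
Proof.
rewrite size_path_length => hM sv sw /andP[pv av] /andP[pw aw].
by rewrite -(pad_strip sv pv) (hM _ _ av aw) pad_strip.
Qed.

End EncodedPaths.

Lemma UP_unique_verifier L : UP L -> exists p R, PP2 R /\ unique_verifier L p R.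
Proof.
move=> [M [hM hL]]; exists (path_length M), (accepts_padded M); split.
  exact: PP2_accepts_padded.
move=> x; split; last by move=> v w; apply: accepts_padded_inj.
rewrite hL; split => [[w /accepts_pad[sw aw]]|[w _ /andP[_ aw]]]; first by eexists; eassumption.
by exists (strip w).
Qed.

Lemma FPt_UPSVt f : FPt f -> UPSVt f.
Proof.
move=> /FPt_FP1/FP_nptm1[M _ hM]; exists M => x; split.
- by move=> v w; rewrite /accepts !hM; case: v w => [|? ?] [].
- by split => // _; exists [::]; rewrite /accepts hM.
- by move=> w v; rewrite hM; case: w => // -[<-].
Qed.

(** * Rankings *)

(* The bijection of the paper, with its values read as binary numerals. *)
Definition ranking n (b t : string) (S : string -> string -> bool) (h : string -> nat) : Prop :=
  [/\ forall w, size w = n -> h w < 2 ^ n,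
      forall v w, size v = n -> size w = n -> h v = h w -> v = w,
      [/\ size b = n, size t = n, h b = 0 & h t = (2 ^ n).-1]
    & forall y z, size y = n -> size z = n -> S y z = (h z == (h y).+1)].

Lemma value_ranking n : ranking n (nseq n false) (nseq n true) lexs value.
Proof.
split.
- by move=> w <-; apply: value_lt.
- by move=> v w <- /esym; apply: value_inj.
- by rewrite !size_nseq value_nseq0 value_nseq1.
- by move=> y z sy sz; rewrite /lexs sy sz eqxx.
Qed.

Section Ranking.
Variables (n : nat) (b t : string) (S : string -> string -> bool) (h : string -> nat).
Hypothesis rk : ranking n b t S h.

(** An injection of the [2 ^ n] words into ['I_(2 ^ n)] is bijective; [g] is its inverse and lists
    the words in order. *)
Lemma ranking_bij : exists g : 'I_(2 ^ n) -> n.-tuple bool,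
  injective g /\ (forall i, h (g i) = i) /\ (forall w : n.-tuple bool, exists i, w = g i).
Proof.
have [lt inj _ _] := rk.
pose f (w : n.-tuple bool) : 'I_(2 ^ n) := Ordinal (lt w (size_tuple w)).
have f_inj : injective f.
  move=> v w [vw]; apply: val_inj => /=.
  by apply: inj vw; rewrite size_tuple.
have [g fK gK] : bijective f by apply: inj_card_bij => //; rewrite card_ord card_tuple card_bool.
exists g; split; first exact: can_inj gK.
by split=> [i|w]; [rewrite -[in RHS](gK i)|exists (f w)].
Qed.

Lemma ranking_surj k : k < 2 ^ n -> exists2 w, size w = n & h w = k.
Proof.
move=> kn; have [g [_ [hg _]]] := ranking_bij.
by exists (g (Ordinal kn)); rewrite ?size_tuple ?hg.
Qed.

Lemma card_interval lo k : lo + k <= 2 ^ n ->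
  #|[pred w : n.-tuple bool | lo <= h w < lo + k]| = k.
Proof.
move=> lk; have [g [g_inj [hg g_onto]]] := ranking_bij.
have lt (i : 'I_k) : lo + i < 2 ^ n by apply: leq_trans lk; rewrite ltn_add2l.
pose g' (i : 'I_k) := g (Ordinal (lt i)).
have g'_inj : injective g' by move=> i j /g_inj [/addnI/ord_inj].
rewrite -[RHS]card_ord -(card_codom g'_inj); apply: eq_card => w; rewrite inE.
apply/idP/codomP => [hw|[i ->]]; last by rewrite hg /= leq_addr ltn_add2l /=.
have [j E] := g_onto w; rewrite E hg in hw.
have jk : j - lo < k by lia.
exists (Ordinal jk); rewrite E /g'; congr g; apply: ord_inj => /=; lia.
Qed.

Lemma ranking_flip : ranking n t b (fun y z => S z y) (fun w => (2 ^ n).-1 - h w).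
Proof.
have [lt inj [sb st hb ht] hS] := rk; split.
- by move=> w /lt; lia.
- by move=> v w sv sw; have := lt _ sv; have := lt _ sw => ? ? E; apply: inj => //; lia.
- by rewrite sb st hb ht; split=> //; lia.
- by move=> y z sy sz; rewrite hS //; have := lt _ sy; have := lt _ sz; lia.
Qed.

End Ranking.

(** The half-open form includes the empty interval [k = 0], so [f x = 0] needs no separate case. *)
Definition rank_interval n (A : string -> bool) (h : string -> nat) k :=
  exists2 lo, lo + k <= 2 ^ n & forall w, size w = n -> A w = (lo <= h w < lo + k).

(* A form of [CLUsharpP] in which the machines are replaced by polynomial-time
   functions and predicates. *)
Definition clustered f (p : {poly nat}) (A : string -> string -> bool) (b t : string -> string)
    (S : string -> string -> string -> bool) :=
  [/\ PP2 A, FP1 b, FP1 t, PP3 S & forall x, exists2 h,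
      ranking p.[size x]%R (b x) (t x) (S x) h & rank_interval p.[size x]%R (A x) h (f x)].

(** The required bijection sends [w] to the [n]-bit numeral of its rank, which turns lexicographic
    conditions into arithmetic ones. *)
Lemma clustered_CLU f p A b t S : clustered f p A b t S -> CLUsharpP f.
Proof.
move=> [hA /FP1_FPt hb /FP1_FPt ht /PP3_polytime_predicate3 hS hx].
have [M balM accM] := balanced_nptm p hA.
exists p, M, b, t, (fun x y z => S x y z); split => // x n.
have [h rk [lo lok hlo]] := hx x; rewrite -/n in rk lok hlo.
have [lt inj [sb st h0 h1] hSx] := rk.
have [g [g_inj [hg g_onto]]] := ranking_bij (value_ranking n).
have onto w : size w = n -> exists i, w = g i.
  by move=> sw; have [i E] := g_onto (Tuple (introT eqP sw)); exists i; rewrite -E.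
pose w_of k := odflt [::] (omap (fun i => tval (g i)) (insub k)).
have w_ofP k : k < 2 ^ n -> size (w_of k) = n /\ value (w_of k) = k.
  by move=> kn; rewrite /w_of insubT /= size_tuple hg.
have hwP w : size w = n -> size (w_of (h w)) = n /\ value (w_of (h w)) = h w.
  by move=> sw; apply: w_ofP; apply: lt.
exists (w_of \o h); split.
- split => [w /hwP[]//|v w|w sw /=].
    rewrite !inE /words /= => sv sw /= E; apply: inj => //.
    by rewrite -(hwP _ sv).2 E (hwP _ sw).2.
  have [v sv hv] := ranking_surj rk (leq_trans (value_lt w) (eq_leq (congr1 _ sw))).
  exists v => //=; apply: value_inj; first by rewrite (hwP _ sv).1 sw.
  by rewrite (hwP _ sv).2 hv.
- split => //=; apply: value_inj; rewrite ?size_nseq ?(hwP _ _).1 //.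
    by rewrite (hwP _ _).2 // value_nseq0.
  by rewrite (hwP _ _).2 // value_nseq1.
- move=> y z sy sz; rewrite hSx //= lex_succ_value (hwP _ sy).1 (hwP _ sz).1 (hwP _ sy).2 (hwP _ sz).2.
  by split=> [/eqP|[_ ->]].
- move=> fx0.
  have [|l sl hl] := @ranking_surj _ _ _ _ _ rk lo; first by lia.
  have [|u su hu] := @ranking_surj _ _ _ _ _ rk (lo + f x).-1; first by lia.
  exists l, u; split => // w sw; rewrite accM sw eqxx hlo //=.
  rewrite !lex_le_value ?(hwP _ sw).1 ?(hwP _ sl).1 ?(hwP _ su).1 //.
  rewrite (hwP _ sw).2 (hwP _ sl).2 (hwP _ su).2 hl hu.
  by split=> [/andP[]|[]]; lia.
- rewrite -(card_interval rk lok); apply: eq_card => w; rewrite !inE accM size_tuple eqxx.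
  by rewrite hlo ?size_tuple.
Qed.

Lemma CLU_clustered f : CLUsharpP f -> exists p A b t S, clustered f p A b t S.
Proof.
move=> [p [M [b [t [prec [balM /FPt_FP1 hb /FPt_FP1 ht /polytime_predicate3_PP3[S hS SE] hx]]]]]].
exists p, (fun x w => accepts M [tuple x] w), b, t, S; split => //; first exact: PP2_accepts.
move=> x; have [h [[hfun hinj hsurj] [sb st h0 h1] hp hlu hf]] := hx x.
set n := (p.[size x])%R in hfun hinj hsurj sb st h0 h1 hp hlu hf *.
have sh w : size w = n -> size (h w) = n by apply: hfun.
have rk : ranking n (b x) (t x) (S x) (fun w => value (h w)).
  split.
  - by move=> w /sh <-; apply: value_lt.
  - move=> v w sv sw E; apply: hinj; rewrite ?inE //.
    by apply: value_inj => //; rewrite !sh.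
  - by rewrite h0 h1 value_nseq0 value_nseq1.
  - move=> y z sy sz; apply/idP/eqP => [/SE/(hp _ _ sy sz)/lex_succ_value[]//|E].
    by apply/SE/(hp _ _ sy sz)/lex_succ_value; rewrite !sh.
exists (fun w => value (h w)) => //.
(* The endpoints are only given for [f x <> 0]. Otherwise no path is accepted, by cardinality, and
   the interval is empty. *)
have [f0|/eqP/hlu[l [u [sl su lu]]]] := eqVneq (f x) 0.
  exists 0; rewrite ?f0 // => w sw; rewrite ltn0 andbF.
  have := card0_eq (etrans (esym hf) f0) (Tuple (introT eqP sw)).
  by rewrite !inE.
have acc w : size w = n -> accepts M [tuple x] w = (value (h l) <= value (h w) < (value (h u)).+1).
  move=> sw; apply/idP/idP => [/(lu _ sw)|/andP[]].
    by rewrite !lex_le_value ?sh // => -[-> /=].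
  by rewrite ltnS => lw wu; apply/(lu _ sw); rewrite !lex_le_value ?sh.
(* If [u] comes before [l], the truncated difference gives the empty interval. *)
pose lo := value (h l); pose k := (value (h u)).+1 - lo.
have lok : lo + k <= 2 ^ n.
  by have := value_lt (h l); have := value_lt (h u); rewrite /k /lo !sh //; lia.
have acc' w : size w = n -> accepts M [tuple x] w = (lo <= value (h w) < lo + k).
  by move=> sw; rewrite acc // /k /lo; lia.
have -> : f x = k.
  rewrite hf -(card_interval rk lok); apply: eq_card => w.
  by rewrite !inE acc' ?size_tuple.
by exists lo.
Qed.

(** * Functions of UPSV and the hardness direction *)

Ltac fp := repeat first
  [ eassumption
  | match goal with
    | H : PP3 _ |- _ => apply: (PP3_comp H)
    | H : PP2 _ |- _ => apply: (PP2_comp H)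
    | H : FP2 _ |- _ => apply: (FP2_comp H)
    | H : FP1 _ |- _ => apply: (FP1_comp H)
    end
  | apply: PP_and | apply: PP_or | apply: PP_not | apply: PP_eq | apply: PP_lexs
  | apply: PP_less | apply: PP_if | apply: FP_if | apply: PP_const
  | apply: FP_takep | apply: FP_dropp | apply: FP_nseq | apply: FP_cat | apply: FP_strip
  | apply: FP_proj | apply: FP_nil ].

Lemma FP1_nseq b (p : {poly nat}) : FP1 (fun x => nseq p.[size x]%R b).
Proof. by rewrite /FP1; fp. Qed.

Lemma PP3_lexs : PP3 (fun=> lexs).
Proof. by rewrite /PP3 /FP3; apply: PP_lexs; fp. Qed.

Lemma FP_size (V : finType) (F : (V -> string) -> string) : FP F ->
  exists p : {poly nat}, forall e, size (F e) <= p.[esize e]%R.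
Proof.
move=> [I [aux [C [inpt [out [p h]]]]]].
have [q hq] : poly_bounded (fun n => (n + p.[n]%R).+1) by poly_bound.
exists q => e; apply: leq_trans (hq _); have [T ex oT] := h e [::] erefl.
exact: exec_out_size (@bounded_tape_of _ _ _ e inpt) ex oT.
Qed.

Lemma value_bin n : value (bin n) = n.
Proof.
have H m : value (rev (mkseq (fun i => odd (n %/ 2 ^ i)) m)) = n %% 2 ^ m.
  elim: m => [|m IH]; first by rewrite expn0 modn1.
  rewrite mkseqS rev_rcons value_cons IH size_rev size_mkseq.
  have := ltn_pmod n (expn_gt0 2 m); move: (divn_eq n (2 ^ m)).
  set q := n %/ 2 ^ m; set r := n %% 2 ^ m => En rm.
  have {}En : n = q./2 * 2 ^ m.+1 + (odd q * 2 ^ m + r).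
    by rewrite {1}En -{1}(odd_double_half q) -muln2 mulnDl -mulnA -expnS addnAC addnC addnA.
  by rewrite [in RHS]En modnMDl modn_small // expnS; case: (odd q); lia.
by rewrite /bin H modn_small // trunc_log_ltn.
Qed.

(** An interval inside the block of the leading digit [a] determines this digit and leaves a
    condition on the offset [o < B]. *)
Lemma block_interval B a u o s k : o < B -> s + k <= B ->
  (a * B + s <= u * B + o < a * B + s + k) = (u == a) && (s <= o < s + k).
Proof.
move=> oB skB; case: (ltngtP u a) => [ua|ua|->] /=.
- have : u.+1 * B <= a * B by rewrite leq_mul2r ua orbT.
  by rewrite mulSn; lia.
- have : a.+1 * B <= u * B by rewrite leq_mul2r ua orbT.
  by rewrite mulSn; lia.
- by rewrite -!addnA leq_add2l ltn_add2l.
Qed.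

Lemma nat_UPSVt_CLU g : nat_UPSVt g -> CLUsharpP g.
Proof.
move=> [M hM]; have [G hG outG] := FP2_output M; have [P hP] := FP_size hG.
pose p := path_length M.
(* A path has at most as many bits as the clock allows, which bounds the input of [G] and hence the
   size of the numeral of [g x]. *)
have [q hq] : poly_bounded (fun n => P.[(n + (clock M).[n]%R)%N]%R) by poly_bound.
pose out x W := G x (strip (take p.[size x]%R W)).
(* The output is brought to [q] bits by leading zeros, since [less] compares values only for strings
   of equal length. *)
pose A x W := accepts_padded M x (take p.[size x]%R W) &&
  less (drop p.[size x]%R W) (drop (size (out x W)) (nseq q.[size x]%R false) ++ out x W).
apply: (@clustered_CLU _ (p + q)%R A _ _ (fun=> lexs)); split.
- have hA := PP2_accepts_padded M; rewrite /PP2 /FP2 /A /out.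
  apply: PP_and; first by fp.
  by apply: PP_less; [fp | apply: FP_cat; [apply: FP_drop|]; fp].
- exact: (FP1_nseq false (p + q)).
- exact: (FP1_nseq true (p + q)).
- exact: PP3_lexs.
move=> x; exists value; first exact: value_ranking.
have [one ex outx] := hM x; have [w accw] : exists w, accepts M [tuple x] w by apply/ex.
have [sw aw] := accepts_pad accw; set W0 := pad _ w in sw aw.
have [v Ev] : exists v, outcome M [tuple x] w = Some (true, v).
  by move: accw; rewrite /accepts; case: outcome => [[[] v]|] // _; exists v.
have [gv] := outx _ _ Ev.
have out0 W : take p.[size x]%R W = W0 -> out x W = bin (g x).
  by rewrite /out => ->; rewrite strip_pad -(outG _ _ _ _ Ev) -gv.
have size_bin : size (bin (g x)) <= q.[size x]%R.
  rewrite gv (outG _ _ _ _ Ev); apply: leq_trans (hP (fun b : bool => if b then x else w)) _.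
  apply: leq_trans (hq _); apply: horner_mono.
  by rewrite /esize big_bool /= leq_add2l (size_path Ev).
have g_lt : g x < 2 ^ q.[size x]%R.
  by rewrite -(value_bin (g x)); apply: leq_trans (value_lt _) _; rewrite leq_exp2l.
rewrite hornerD; set n1 := (p.[_])%R in sw out0 *; set n2 := (q.[_])%R in size_bin g_lt *.
have E2 : 2 ^ (n1 + n2)%R = 2 ^ n1 * 2 ^ n2 by rewrite -expnD.
(* The rank of the first word with prefix [W0]; the [g x] counted words start there. *)
exists (value W0 * 2 ^ n2).
  rewrite E2; have := value_lt W0; rewrite sw -/n1 => h.
  have : (value W0).+1 * 2 ^ n2 <= 2 ^ n1 * 2 ^ n2 by rewrite leq_mul2r h orbT.
  by rewrite mulSn; lia.
move=> W sW; have su : size (take n1 W) = n1 by rewrite size_takel // sW; apply: leq_addr.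
have sv : size (drop n1 W) = n2 by rewrite size_drop sW; apply: addKn.
have -> : value W = value (take n1 W) * 2 ^ n2 + value (drop n1 W).
  by rewrite -{1}(cat_take_drop n1 W) value_cat sv.
have := @block_interval (2 ^ n2) (value W0) (value (take n1 W)) (value (drop n1 W)) 0 (g x).
rewrite !addn0 add0n => ->; [|by rewrite -sv value_lt|exact: ltnW].
have -> : (value (take n1 W) == value W0) = (take n1 W == W0).
  by apply/eqP/eqP => [|->] //; apply: value_inj; rewrite su.
rewrite /A -/n1 -/n2; case: eqP => [E|ne] /=.
  rewrite E aw /= out0 // lessE; last first.
    by rewrite sv size_cat size_drop size_nseq subnK.
  by rewrite value_cat drop_nseq value_nseq0 mul0n value_bin.
apply: contra_notF ne => /andP[h _].
by apply: (accepts_padded_inj (M := M) one) => //; rewrite ?su.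
Qed.

(** In the lexicographic order a unique witness is an interval with one element. *)
Lemma set_char_CLU (L : string -> Prop) : UP L -> CLUsharpP (fun x => `[< L x >]).
Proof.
move=> /UP_unique_verifier[p [R [hR hL]]].
apply: (@clustered_CLU _ p R _ _ (fun=> lexs)); split => //.
- exact: (FP1_nseq false p).
- exact: (FP1_nseq true p).
- exact: PP3_lexs.
move=> x; exists value; first exact: value_ranking.
have [hLx uniqx] := hL x; case: asboolP => [/hLx[w sw Rw]|nL].
  exists (value w); first by rewrite addn1 -sw value_lt.
  move=> v sv; rewrite addn1 ltnS -eqn_leq; apply/idP/eqP => [Rv|E].
    by rewrite (uniqx v w).
  by rewrite -(value_inj _ E) // sw.
exists 0 => // v sv; rewrite ltn0 andbF; apply/negbTE/negP => Rv.
by apply: nL; apply/hLx; exists v.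
Qed.

(* The successor relation of the cyclic order obtained by closing up the order
   from [b] to [t] with successor relation [S]. *)
Definition cyc (b t : string) (S : string -> string -> bool) (y z : string) :=
  S y z || (y == t) && (z == b).

(** * Cyclic orders, and the increment as a test for singletons *)

Section Cyclic.
Variables (n : nat) (b t : string) (S : string -> string -> bool) (h : string -> nat).
Hypothesis rk : ranking n b t S h.

Lemma ranking_eqt y : size y = n -> (y == t) = (h y == (2 ^ n).-1).
Proof.
have [_ inj [_ st _ ht] _] := rk => sy.
by apply/eqP/eqP => [->|E] //; apply: inj => //; rewrite ht.
Qed.

Lemma ranking_eqb y : size y = n -> (y == b) = (h y == 0).
Proof.
have [_ inj [sb _ hb _] _] := rk => sy.
by apply/eqP/eqP => [->|E] //; apply: inj => //; rewrite hb.
Qed.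

Lemma ranking_eq y z : size y = n -> size z = n -> (y == z) = (h y == h z).
Proof.
have [_ inj _ _] := rk => sy sz.
by apply/eqP/eqP => [->|E] //; apply: inj.
Qed.

Lemma cycE y z : size y = n -> size z = n ->
  cyc b t S y z = (h z == (h y).+1) || (h y == (2 ^ n).-1) && (h z == 0).
Proof.
move=> sy sz; have [_ _ _ hS] := rk.
by rewrite /cyc hS // ranking_eqt // ranking_eqb.
Qed.

End Cyclic.

Lemma PP_cyc (V : finType) b t S (X Y Z : (V -> string) -> string) :
  FP1 b -> FP1 t -> PP3 S -> FP X -> FP Y -> FP Z ->
  PP (fun e => cyc (b (X e)) (t (X e)) (S (X e)) (Y e) (Z e)).
Proof. by move=> *; rewrite /cyc; fp. Qed.

Lemma increment_UP (L : string -> Prop) :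
  (forall f, CLUsharpP f -> CLUsharpP (fun x => f x + 1)) -> UP L -> UP (fun x => ~ L x).
Proof.
move=> inc /set_char_CLU/inc/CLU_clustered[p [A [b [t [S [hA hb ht hS hx]]]]]].
pose y (x W : string) := take p.[size x]%R W.
pose y0 (x W : string) := take p.[size x]%R (drop p.[size x]%R W).
pose y1 (x W : string) := drop p.[size x]%R (drop p.[size x]%R W).
(* In an interval of two words each is a neighbour of the other, so one of the last two conditions
   fails. The equalities [y0 = y] and [y1 = y] admit the order with a single word, which is its own
   neighbour. *)
pose R x W := [&& A x (y x W), cyc (b x) (t x) (S x) (y0 x W) (y x W),
  cyc (b x) (t x) (S x) (y x W) (y1 x W),
  (y0 x W == y x W) || ~~ A x (y0 x W) & (y1 x W == y x W) || ~~ A x (y1 x W)].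
apply: (@unique_verifier_UP _ (p + p + p)%R R).
  rewrite /PP2 /FP2 /R /y /y0 /y1; do !apply: PP_and; try apply: PP_cyc; fp.
move=> x; have [h rk [lo lok hlo]] := hx x.
rewrite !hornerD; set n := (p.[size x])%R in rk lok hlo *.
have [lt inj _ _] := rk.
have sizes W : size W = (n + n + n)%R ->
    [/\ size (y x W) = n, size (y0 x W) = n & size (y1 x W) = n].
  rewrite /y /y0 /y1 -/n => sW; have {}sW : size W = n + n + n := sW.
  by rewrite !size_take_min !size_drop sW; split; lia.
have RE W : size W = (n + n + n)%R -> R x W -> ~ L x /\
    [/\ h (y x W) = lo,
       h (y0 x W) = (if lo == 0 then (2 ^ n).-1 else lo.-1) &
       h (y1 x W) = (if lo == (2 ^ n).-1 then 0 else lo.+1)].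
  move=> /sizes[sy s0 s1]; rewrite /R !(cycE rk) // !(ranking_eq rk) // !hlo //.
  have := lt _ sy; have := lt _ s0; have := lt _ s1.
  move: (h (y x W)) (h (y0 x W)) (h (y1 x W)) => a a0 a1 ha1 ha0 ha.
  case: asboolP lok => HL /= lok /and5P[]; first lia.
  by move=> *; split=> //; split; first [lia | case: eqP; lia].
split; last first.
  move=> V W sV sW /(RE _ sV)[_ [v v0 v1]] /(RE _ sW)[_ [w w0 w1]].
  have [sv sv0 sv1] := sizes _ sV; have [sw sw0 sw1] := sizes _ sW.
  rewrite -(cat_take_drop n V) -(cat_take_drop n W).
  rewrite -(cat_take_drop n (drop n V)) -(cat_take_drop n (drop n W)).
  congr (_ ++ (_ ++ _)); apply: inj => //.
  - by rewrite [LHS]v -w.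
  - by rewrite [LHS]v0 -w0.
  - by rewrite [LHS]v1 -w1.
split => [nL|[W sW /(RE _ sW)[]]] //.
have lo_lt : lo < 2 ^ n by lia.
have N0 : 0 < 2 ^ n by rewrite expn_gt0.
have [u su hu] := ranking_surj rk lo_lt.
have [|u0 su0 hu0] := @ranking_surj _ _ _ _ _ rk (if lo == 0 then (2 ^ n).-1 else lo.-1).
  by case: eqP; lia.
have [|u1 su1 hu1] := @ranking_surj _ _ _ _ _ rk (if lo == (2 ^ n).-1 then 0 else lo.+1).
  by case: eqP; lia.
exists (u ++ u0 ++ u1); first by rewrite !size_cat su su0 su1; apply: addnA.
have yE : y x (u ++ u0 ++ u1) = u by rewrite /y -/n -su take_size_cat.
have y0E : y0 x (u ++ u0 ++ u1) = u0 by rewrite /y0 -/n -{1}su0 -su drop_size_cat // take_size_cat.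
have y1E : y1 x (u ++ u0 ++ u1) = u1.
  by rewrite /y1 -/n -{2}su drop_size_cat // -su0 drop_size_cat.
rewrite /R yE y0E y1E !(cycE rk) // !(ranking_eq rk) // !hlo // hu.
rewrite (asboolF nL) add0n; apply/and5P; split; move: hu0 hu1; case: eqP; case: eqP; lia.
Qed.

(** * Certificates for the last counted path *)

Section Rotation.
Variables (n : nat) (b t : string) (S : string -> string -> bool) (h : string -> nat).
Hypothesis rk : ranking n b t S h.
Variables (u v : string).

(* The cyclic order cut between [u] and its successor [v]; if [v] is not the
   successor of [u] the order is left unchanged. *)
Definition rot_first := if cyc b t S u v then v else b.
Definition rot_last := if cyc b t S u v then u else t.
Definition rot_succ y z := if cyc b t S u v then (y != u) && cyc b t S y z else S y z.

(** The words after [u] come first and those up to [u] follow, so [u] gets the last rank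
    [2 ^ n - 1]. *)
Definition rot_rank w :=
  if cyc b t S u v then (if h u < h w then h w - (h u).+1 else h w + (2 ^ n - (h u).+1))
  else h w.

Lemma rot_ranking : size u = n -> size v = n ->
  ranking n rot_first rot_last rot_succ rot_rank.
Proof.
move=> su sv; rewrite /rot_first /rot_last /rot_succ /rot_rank.
case: ifP => // uv; have [lt inj _ _] := rk.
have hu := lt _ su; have hv := lt _ sv; move: uv; rewrite (cycE rk) // => uv.
split.
- by move=> w /lt hw; case: (ltnP (h u) (h w)); lia.
- move=> y z sy sz E; apply: inj => //; have := lt _ sy; have := lt _ sz.
  by move: E; case: (ltnP (h u) (h y)); case: (ltnP (h u) (h z)); lia.
- by split=> //; [case: (ltnP (h u) (h v))|case: (ltnP (h u) (h u))]; lia.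
- move=> y z sy sz; rewrite (cycE rk) // (ranking_eq rk) //.
  have := lt _ sy; have := lt _ sz.
  by case: (ltnP (h u) (h y)); case: (ltnP (h u) (h z)); lia.
Qed.

End Rotation.

(** Polynomial time for four arguments, stated directly as closure under substitution. *)
Definition closed4 (S : string -> string -> string -> string -> bool) :=
  forall (V : finType) (X C Y Z : (V -> string) -> string),
  FP X -> FP C -> FP Y -> FP Z -> PP (fun e => S (X e) (C e) (Y e) (Z e)).

(* The unique valid certificate [c] for [x] yields an order in which the set
   counted by [f] is a final segment. *)
Definition certified f (p m : {poly nat}) (A D : string -> string -> bool)
    (F L : string -> string -> string) (S : string -> string -> string -> string -> bool) :=
  [/\ PP2 A, PP2 D, FP2 F, FP2 L & closed4 S] /\
  forall x, (exists2 c0, size c0 = m.[size x]%R &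
      forall c, size c = m.[size x]%R -> D x c = (c == c0)) /\
    forall c, size c = m.[size x]%R -> exists2 h,
      ranking p.[size x]%R (F x c) (L x c) (S x c) h &
      D x c -> f x <= 2 ^ p.[size x]%R /\
        forall w, size w = p.[size x]%R -> A x w = (2 ^ p.[size x]%R <= h w + f x).

Lemma split3 (c : string) p q : size c = p + p + q -> exists u v w,
  [/\ c = u ++ v ++ w, size u = p, size v = p & size w = q].
Proof.
move=> sc; exists (take p c), (take p (drop p c)), (drop p (drop p c)).
by rewrite !cat_take_drop !size_take_min !size_drop sc; split=> //; lia.
Qed.

Section Certificate.
Variables (f : string -> nat) (p : {poly nat}) (A : string -> string -> bool).
Variables (b t : string -> string) (S : string -> string -> string -> bool).
Hypothesis cl : clustered f p A b t S.

(* [u] is the last element of the interval counted by [f], and [v] its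
   successor in the cyclic order. *)
Definition is_last (x u v : string) :=
  [&& A x u, cyc (b x) (t x) (S x) u v & (u == t x) || ~~ A x v].

(** If [u] is the greatest word, its cyclic successor [b x] may itself be counted, so nothing is
    asked of [v]. In all other cases an uncounted [v] means that the interval ends at [u]. *)
Lemma is_lastE x h lo u v : ranking p.[size x]%R (b x) (t x) (S x) h ->
  lo + f x <= 2 ^ p.[size x]%R ->
  (forall w, size w = p.[size x]%R -> A x w = (lo <= h w < lo + f x)) ->
  size u = p.[size x]%R -> size v = p.[size x]%R ->
  is_last x u v = [&& 0 < f x, h u == (lo + f x).-1 & cyc (b x) (t x) (S x) u v].
Proof.
move=> rk lok hlo su sv; rewrite /is_last (ranking_eqt rk) // !hlo // (cycE rk) //.
by have [lt _ _ _] := rk; have := lt _ su; have := lt _ sv; lia.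
Qed.

Lemma is_last_gt0 x u v : size u = p.[size x]%R -> size v = p.[size x]%R ->
  is_last x u v -> 0 < f x.
Proof.
move=> su sv; have [_ _ _ _ /(_ x)[h rk [lo lok hlo]]] := cl.
by rewrite (is_lastE rk lok hlo) // => /andP[].
Qed.

Lemma is_last_spec x : 0 < f x ->
  exists d1 d2, [/\ size d1 = p.[size x]%R, size d2 = p.[size x]%R &
    forall u v, size u = p.[size x]%R -> size v = p.[size x]%R ->
    is_last x u v = (u == d1) && (v == d2)].
Proof.
move=> fx; have [_ _ _ _ /(_ x)[h rk [lo lok hlo]]] := cl.
have [lt _ _ _] := rk.
have [|d1 s1 h1] := @ranking_surj _ _ _ _ _ rk (lo + f x).-1; first by lia.
have [|d2 s2 h2] := @ranking_surj _ _ _ _ _ rk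
  (if h d1 == (2 ^ p.[size x]%R).-1 then 0 else (h d1).+1).
  have := expn_gt0 2 p.[size x]%R; have := lt _ s1.
  by case: (eqVneq (h d1) (2 ^ p.[size x]%R).-1); lia.
exists d1, d2; split=> // u v su sv.
rewrite (is_lastE rk lok hlo) // fx (cycE rk) // !(ranking_eq rk) // -h1.
have := lt _ su; have := lt _ sv; have := lt _ s1.
by move: h2; case: (eqVneq (h u) (h d1)) => [->|] /=; case: (eqVneq (h d1) (2 ^ p.[size x]%R).-1) => /=; lia.
Qed.

Lemma PP_is_last (V : finType) (X Y Z : (V -> string) -> string) :
  FP X -> FP Y -> FP Z -> PP (fun e => is_last (X e) (Y e) (Z e)).
Proof.
have [hA hb ht hS _] := cl => hX hY hZ; rewrite /is_last.
by do !apply: PP_and; try apply: PP_cyc; fp.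
Qed.

(** The last counted path with its cyclic successor is a unique witness. Through [UP = coUP] this
    provides unique witnesses for [f x = 0]. *)
Lemma UP_positive : UP (fun x => 0 < f x).
Proof.
apply: (@unique_verifier_UP _ (p + p)%R
  (fun x c => is_last x (take p.[size x]%R c) (drop p.[size x]%R c))).
  by rewrite /PP2 /FP2; apply: PP_is_last; fp.
move=> x; rewrite hornerD; set n := (p.[_])%R.
have sizes c : size c = (n + n)%R -> size (take n c) = n /\ size (drop n c) = n.
  move=> sc; have {}sc : size c = n + n := sc.
  by rewrite size_take_min size_drop sc; lia.
split=> [|c c' /sizes[s1 s2] /sizes[s1' s2'] h].
  split=> [/is_last_spec[d1 [d2 [s1 s2 E]]]|[c /sizes[s1 s2]]]; last exact: is_last_gt0.
  exists (d1 ++ d2); first by rewrite size_cat s1 s2.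
  by rewrite -[n]s1 take_size_cat // drop_size_cat // E ?eqxx.
have [d1 [d2 [_ _ E]]] := is_last_spec (is_last_gt0 s1 s2 h).
move: h; rewrite !E // => /andP[/eqP e1 /eqP e2] /andP[/eqP e1' /eqP e2'].
by rewrite -(cat_take_drop n c) e1 e2 -e1' -e2' cat_take_drop.
Qed.

Hypothesis UPcoUP : UP = coUP.

Lemma zero_verifier : exists q R, PP2 R /\ unique_verifier (fun x => f x = 0) q R.
Proof.
have := UP_positive; rewrite UPcoUP => -[L /UP_unique_verifier[q [R [hR ver]]] E].
exists q, R; split=> // x; have [h1 h2] := ver x; split=> //; rewrite -h1.
have {}E : (~ L x) = (0 < f x) :> Prop by have := congr1 (@^~ x) E.
split=> [f0|Lx]; first by apply: contrapT; rewrite E f0.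
by apply/eqP; rewrite -leqn0 leqNgt; apply/negP; rewrite -[is_true _]E; apply.
Qed.

(** If [f x > 0], the order is cut behind the last counted path, which turns the interval into a
    final segment. If [f x = 0], the empty segment is final in any order, so the cut does not matter
    and only uniqueness has to be ensured. *)
Lemma clustered_certified : exists m D F L S', certified f p m A D F L S'.
Proof.
have [hA hb ht hS hx] := cl; have [q [R [hR ver]]] := zero_verifier.
pose u (x c : string) := take p.[size x]%R c.
pose v (x c : string) := take p.[size x]%R (drop p.[size x]%R c).
pose w (x c : string) := drop p.[size x]%R (drop p.[size x]%R c).
have parts x c1 c2 c3 : size c1 = p.[size x]%R -> size c2 = p.[size x]%R ->
    [/\ u x (c1 ++ c2 ++ c3) = c1, v x (c1 ++ c2 ++ c3) = c2 & w x (c1 ++ c2 ++ c3) = c3].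
  move=> s1 s2; rewrite /u /v /w -{1 3 5}s1 take_size_cat // drop_size_cat //.
  by rewrite -s2 take_size_cat // drop_size_cat.
(* The two kinds of certificates share one format. The parts that a kind does not use are fixed to
   zeros, as they would otherwise spoil uniqueness. *)
pose D x c := is_last x (u x c) (v x c) && (w x c == nseq q.[size x]%R false) ||
  [&& u x c == nseq p.[size x]%R false, v x c == nseq p.[size x]%R false & R x (w x c)].
exists (p + p + q)%R, D,
  (fun x c => rot_first (b x) (t x) (S x) (u x c) (v x c)),
  (fun x c => rot_last (b x) (t x) (S x) (u x c) (v x c)),
  (fun x c => rot_succ (b x) (t x) (S x) (u x c) (v x c)).
split; first split=> //.
- rewrite /PP2 /FP2 /D /u /v /w; apply: PP_or; last by fp.
  by apply: PP_and; [apply: PP_is_last|]; fp.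
- by rewrite /FP2 /rot_first /u /v; apply: FP_if; [apply: PP_cyc|..]; fp.
- by rewrite /FP2 /rot_last /u /v; apply: FP_if; [apply: PP_cyc|..]; fp.
- move=> V X C Y Z hX hC hY hZ; rewrite /rot_succ /u /v.
  by apply: PP_if; [|apply: PP_and|]; try apply: PP_cyc; fp.
move=> x; rewrite !hornerD; set n := (p.[_])%R; set m := (q.[_])%R.
have cat3 (c : string) : size c = (n + n + m)%R -> exists c1 c2 c3,
    [/\ c = c1 ++ c2 ++ c3, size c1 = n, size c2 = n & size c3 = m].
  by move=> sc; exact: (@split3 c n m sc).
have eq3 (c1 c2 c3 d1 d2 d3 : string) : size c1 = n -> size c2 = n -> size d1 = n -> size d2 = n ->
    (c1 ++ c2 ++ c3 == d1 ++ d2 ++ d3) = [&& c1 == d1, c2 == d2 & c3 == d3].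
  by move=> s1 s2 s1' s2'; rewrite !eqseq_cat ?s1 ?s2.
have [verx uniqx] := ver x.
split.
  have [f0|f_gt0] := posnP (f x).
    have /verx[w0 sw0 Rw0] := f0.
    exists (nseq n false ++ nseq n false ++ w0); first by rewrite !size_cat !size_nseq sw0; exact: addnA.
    move=> _ /cat3[c1 [c2 [c3 [-> s1 s2 s3]]]].
    rewrite /D; have [-> -> ->] := parts x c1 c2 c3 s1 s2.
    rewrite eq3 ?size_nseq //; case E : (is_last x c1 c2) => /=.
      by have := is_last_gt0 s1 s2 E; rewrite f0.
    case: (c1 == _) => //=; case: (c2 == _) => //=.
    by apply/idP/eqP => [Rc|-> //]; apply: uniqx.
  have [d1 [d2 [s1' s2' E]]] := is_last_spec f_gt0.
  exists (d1 ++ d2 ++ nseq m false); first by rewrite !size_cat size_nseq s1' s2'; exact: addnA.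
  move=> _ /cat3[c1 [c2 [c3 [-> s1 s2 s3]]]].
  rewrite /D; have [-> -> ->] := parts x c1 c2 c3 s1 s2.
  have -> : R x c3 = false.
    by apply/negbTE/negP => Rc; have := verx.2 (ex_intro2 _ _ c3 s3 Rc); lia.
  by rewrite eq3 // E // !andbF orbF -andbA.
move=> _ /cat3[c1 [c2 [c3 [-> s1 s2 s3]]]].
rewrite /D; have [-> -> ->] := parts x c1 c2 c3 s1 s2.
have [h rk [lo lok hlo]] := hx x.
rewrite -/n in rk lok hlo.
exists (rot_rank n (b x) (t x) (S x) h c1 c2); first exact: rot_ranking.
move=> hD; split; first by lia.
have [rlt _ _ _] := rot_ranking rk s1 s2.
move=> y sy; rewrite hlo //; have := rlt _ sy.
have [->|f_gt0] := posnP (f x); first by rewrite addn0; lia.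
case/orP: hD => [/andP[]|/and3P[_ _ Rc]]; last first.
  by have := verx.2 (ex_intro2 _ _ c3 s3 Rc); lia.
rewrite (is_lastE rk lok hlo) // f_gt0 /= => /andP[/eqP h1 uv] _.
rewrite /rot_rank uv; have [lt _ _ _] := rk; have := lt _ s1; have := lt _ sy.
by move: lok; rewrite -/n; case: (ltnP (h c1) (h y)); lia.
Qed.

End Certificate.

(** * Sums *)

Lemma clustered_flip f p A b t S : clustered f p A b t S ->
  clustered f p A t b (fun x y z => S x z y).
Proof.
move=> [hA hb ht hS hx]; split=> //.
  by rewrite /PP3 /FP3; apply: (PP3_comp hS); fp.
move=> x; have [h rk [lo lok hlo]] := hx x.
exists (fun w => (2 ^ p.[size x]%R).-1 - h w); first exact: ranking_flip.
exists (2 ^ p.[size x]%R - (lo + f x)); first by lia.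
by move=> w sw; rewrite hlo //; have [lt _ _ _] := rk; have := lt _ sw; lia.
Qed.

(* The lexicographic product: the first [k] bits [c] of a string are compared
   lexicographically, the remaining bits along an order that depends on [c]. *)
Section Product.
Variables (k : nat) (F L : string -> string) (S : string -> string -> string -> bool).

Definition dep_succ (W W' : string) :=
  (take k W == take k W') && S (take k W) (drop k W) (drop k W') ||
  [&& lexs (take k W) (take k W'), drop k W == L (take k W) & drop k W' == F (take k W')].

Definition dep_first := nseq k false ++ F (nseq k false).
Definition dep_last := nseq k true ++ L (nseq k true).

Definition dep_rank n (h : string -> string -> nat) W :=
  value (take k W) * 2 ^ n + h (take k W) (drop k W).

(** The last word of each block has offset [2 ^ n - 1] and the first word of the next block offset
    0, so the ranks continue across the boundary. An order is needed for every prefix [c]. *)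
Lemma dep_ranking n h :
  (forall c, size c = k -> ranking n (F c) (L c) (S c) (h c)) ->
  ranking (k + n) dep_first dep_last dep_succ (dep_rank n h).
Proof.
move=> rk; rewrite /dep_first /dep_last /dep_succ /dep_rank.
have sizes (W : string) : size W = k + n -> size (take k W) = k /\ size (drop k W) = n.
  by move=> sW; rewrite size_take_min size_drop sW; lia.
have sn (b : bool) : size (nseq k b) = k by rewrite size_nseq.
have tk (b : bool) s : take k (nseq k b ++ s) = nseq k b by rewrite take_size_cat.
have dk (b : bool) s : drop k (nseq k b ++ s) = s by rewrite drop_size_cat.
have N0 : 0 < 2 ^ n by rewrite expn_gt0.
have K0 : 0 < 2 ^ k by rewrite expn_gt0.
split.
- move=> W /sizes[sc sy]; have [lt _ _ _] := rk _ sc.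
  have := lt _ sy; have := value_lt (take k W); rewrite sc expnD.
  by move: (value _) (h _ _) => v r hv hr; nia.
- move=> V W sV sW; have [sc sy] := sizes _ sV; have [sc' sy'] := sizes _ sW.
  have [lt inj _ _] := rk _ sc; have [lt' _ _ _] := rk _ sc'.
  (* The quotient by [2 ^ n] recovers the prefix, and with it the order in which the remainders are
     compared. *)
  move=> E; have := congr1 (divn^~ (2 ^ n)) E; rewrite /= !divnMDl //.
  rewrite !divn_small ?addn0 ?lt ?lt' // => /(value_inj (etrans sc (esym sc'))) Ec.
  move: E; rewrite Ec => /addnI E; rewrite -(cat_take_drop k V) -(cat_take_drop k W) Ec.
  by rewrite -Ec in E; rewrite (inj _ _ sy sy' E).
- have [_ _ [sF _ hF _] _] := rk _ (sn false); have [_ _ [_ sL _ hL] _] := rk _ (sn true).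
  rewrite !size_cat !sn sF sL !tk !dk hF hL value_nseq0 value_nseq1; split=> //.
  by rewrite expnD; nia.
- move=> Y Z sY sZ; have [sc sy] := sizes _ sY; have [sc' sz] := sizes _ sZ.
  have [lt _ _ hS] := rk _ sc; have [lt' _ _ _] := rk _ sc'.
  rewrite (ranking_eqt (rk _ sc)) // (ranking_eqb (rk _ sc')) // hS //.
  rewrite /lexs sc sc' eqxx /=.
  have := lt _ sy; have := lt' _ sz.
  have -> : (take k Y == take k Z) = (value (take k Y) == value (take k Z)).
    by apply/eqP/eqP => [->//|]; apply: value_inj; rewrite sc.
  case: (eqVneq (value (take k Y)) (value (take k Z))) => [E|ne].
    rewrite (value_inj (etrans sc (esym sc')) E).
    move: (value _) (h _ _) (h _ _) => v r r' hr' hr; rewrite -addnS eqn_add2l.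
    by rewrite [v == v.+1]ltn_eqF ?leqnn // orbF.
  move: ne; move: (value (take k Y)) (value (take k Z)) (h _ _) (h _ _) => v v' r r' ne hr' hr /=.
  apply/idP/idP => [/and3P[/eqP-> /eqP-> /eqP->]|/eqP E]; first by rewrite mulSn; lia.
  have lev : v < v'.
    by rewrite ltn_neqAle ne /= leqNgt; apply/negP => lt1; nia.
  have [ve|ne'] := eqVneq v' v.+1; last by exfalso; nia.
  by move: E; rewrite ve mulSn /=; lia.
Qed.

End Product.

Section ProductFP.
Variables (V : finType) (k : (V -> string) -> nat).
Variables (F L : (V -> string) -> string -> string).
Variable S : (V -> string) -> string -> string -> string -> bool.
Hypothesis hk : FP (fun e => nseq (k e) true).
Hypothesis hF : forall C, FP C -> FP (fun e => F e (C e)).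
Hypothesis hL : forall C, FP C -> FP (fun e => L e (C e)).
Hypothesis hS : forall C Y Z, FP C -> FP Y -> FP Z -> PP (fun e => S e (C e) (Y e) (Z e)).

Lemma FP_nseq_size b : FP (fun e => nseq (k e) b).
Proof. by apply: FP_ext (FP_map (fun=> b) hk) => e; rewrite map_nseq. Qed.

Lemma FP_take_size W : FP W -> FP (fun e => take (k e) (W e)).
Proof. by move=> /(FP_take hk); apply: FP_ext => e; rewrite size_nseq. Qed.

Lemma FP_drop_size W : FP W -> FP (fun e => drop (k e) (W e)).
Proof. by move=> /(FP_drop hk); apply: FP_ext => e; rewrite size_nseq. Qed.

Lemma FP_dep_first : FP (fun e => dep_first (k e) (F e)).
Proof. by apply: FP_cat; [|apply: hF]; apply: FP_nseq_size. Qed.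

Lemma FP_dep_last : FP (fun e => dep_last (k e) (L e)).
Proof. by apply: FP_cat; [|apply: hL]; apply: FP_nseq_size. Qed.

Lemma PP_dep_succ W W' : FP W -> FP W' ->
  PP (fun e => dep_succ (k e) (F e) (L e) (S e) (W e) (W' e)).
Proof.
move=> hW hW'; rewrite /dep_succ.
have hC := FP_take_size hW; have hC' := FP_take_size hW'.
have hY := FP_drop_size hW; have hY' := FP_drop_size hW'.
apply: PP_or; first by apply: PP_and; [exact: PP_eq|exact: hS].
by apply: PP_and; [exact: PP_lexs|apply: PP_and; apply: PP_eq => //; [exact: hL|exact: hF]].
Qed.

End ProductFP.

(** As [k <= N], the last [k] of the numbers below [M * N] lie within the last block. *)
Lemma final_segment N M a r k : a < M -> r < N -> k <= N ->
  (a == M.-1) && (N <= r + k) = (M * N <= a * N + r + k).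
Proof.
move=> aM rN kN; have [E|ne] := eqVneq a M.-1.
  by have -> : M = a.+1; [lia|rewrite mulSn; lia].
have : a.+2 * N <= M * N by rewrite leq_mul2r; apply/orP; right; lia.
by rewrite !mulSn; lia.
Qed.

Lemma initial_segment N a r k : r < N -> k <= N ->
  (a == 0) && (r < k) = (a * N + r < k).
Proof.
by move=> rN kN; case: a => [|a] //=; rewrite mulSn; lia.
Qed.

Section Sum.
Variables (f g : string -> nat) (p1 m1 p2 m2 : {poly nat}).
Variables (A1 D1 A2 D2 : string -> string -> bool) (F1 L1 F2 L2 : string -> string -> string).
Variables (S1 S2 : string -> string -> string -> string -> bool).
Hypotheses (cf : certified f p1 m1 A1 D1 F1 L1 S1) (cg : certified g p2 m2 A2 D2 F2 L2 S2).

(* A string is made of certificates for [f] and [g], a bit that selects [f] or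
   [g], a padding and a path for the selected function. In the block of the
   valid certificates, the paths counted by [f] form a final segment of the
   first half. As the order for [g] is reversed, the paths counted by [g] form
   an initial segment of the second half. *)

Definition sum_first (x c s : string) :=
  if s == [:: false] then dep_first p2.[size x]%R (fun=> F1 x (take m1.[size x]%R c))
  else dep_first p1.[size x]%R (fun=> L2 x (drop m1.[size x]%R c)).

Definition sum_last (x c s : string) :=
  if s == [:: false] then dep_last p2.[size x]%R (fun=> L1 x (take m1.[size x]%R c))
  else dep_last p1.[size x]%R (fun=> F2 x (drop m1.[size x]%R c)).

Definition sum_succ (x c s Y Z : string) :=
  if s == [:: false] then
    dep_succ p2.[size x]%R (fun=> F1 x (take m1.[size x]%R c))
      (fun=> L1 x (take m1.[size x]%R c)) (fun=> S1 x (take m1.[size x]%R c)) Y Z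
  else
    dep_succ p1.[size x]%R (fun=> L2 x (drop m1.[size x]%R c))
      (fun=> F2 x (drop m1.[size x]%R c)) (fun _ y z => S2 x (drop m1.[size x]%R c) z y) Y Z.

(** A path for [f] is padded with [p2] bits and one for [g] with [p1] bits, so both halves have
    words of the same length. Padding with ones moves the segment for [f] to the end of its half,
    padding with zeros moves that for [g] to the beginning of the other. *)
Definition sum_accepts (x W : string) :=
  let c := take (m1 + m2).[size x]%R W in
  let s := take 1 (drop (m1 + m2).[size x]%R W) in
  let r := drop 1 (drop (m1 + m2).[size x]%R W) in
  [&& D1 x (take m1.[size x]%R c), D2 x (drop m1.[size x]%R c) &
    if s == [:: false] then
      (take p2.[size x]%R r == nseq p2.[size x]%R true) && A1 x (drop p2.[size x]%R r)
    else (take p1.[size x]%R r == nseq p1.[size x]%R false) && A2 x (drop p1.[size x]%R r)].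

Lemma sum_clustered : clustered (fun x => f x + g x) (m1 + m2 + (1 + (p2 + p1)))%R sum_accepts
  (fun x => dep_first (m1 + m2).[size x]%R (fun c => dep_first 1 (sum_first x c)))
  (fun x => dep_last (m1 + m2).[size x]%R (fun c => dep_last 1 (sum_last x c)))
  (fun x => dep_succ (m1 + m2).[size x]%R (fun c => dep_first 1 (sum_first x c))
     (fun c => dep_last 1 (sum_last x c))
     (fun c => dep_succ 1 (sum_first x c) (sum_last x c) (sum_succ x c))).
Proof.
have [[hA1 hD1 hF1 hL1 hS1] cfx] := cf; have [[hA2 hD2 hF2 hL2 hS2] cgx] := cg.
have one1 (V : finType) : FP (fun e : V -> string => nseq 1 true) by apply: FP_nseq_true.
have hfirst (V : finType) (X C s : (V -> string) -> string) : FP X -> FP C -> FP s ->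
    FP (fun e => sum_first (X e) (C e) (s e)).
  move=> hX hC hs; rewrite /sum_first; apply: FP_if; first by apply: PP_eq => //; apply: PP_const.
    by apply: FP_dep_first => [|c hc]; [exact: FP_ones|fp].
  by apply: FP_dep_first => [|c hc]; [exact: FP_ones|fp].
have hlast (V : finType) (X C s : (V -> string) -> string) : FP X -> FP C -> FP s ->
    FP (fun e => sum_last (X e) (C e) (s e)).
  move=> hX hC hs; rewrite /sum_last; apply: FP_if; first by apply: PP_eq => //; apply: PP_const.
    by apply: FP_dep_last => [|c hc]; [exact: FP_ones|fp].
  by apply: FP_dep_last => [|c hc]; [exact: FP_ones|fp].
have hsucc (V : finType) (X C s Y Z : (V -> string) -> string) :
    FP X -> FP C -> FP s -> FP Y -> FP Z -> PP (fun e => sum_succ (X e) (C e) (s e) (Y e) (Z e)).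
  move=> hX hC hs hY hZ; rewrite /sum_succ; apply: PP_if; first by apply: PP_eq => //; apply: PP_const.
    apply: PP_dep_succ => //; [exact: FP_ones|by move=> c hc; fp|by move=> c hc; fp|].
    by move=> c y z hc hy hz; apply: hS1 => //; fp.
  apply: PP_dep_succ => //; [exact: FP_ones|by move=> c hc; fp|by move=> c hc; fp|].
  by move=> c y z hc hy hz; apply: hS2 => //; fp.
split.
- have hx := FP_proj (true : bool); have hW := FP_proj (false : bool).
  have hc := FP_takep (m1 + m2) hx hW; have hd := FP_dropp (m1 + m2) hx hW.
  have hs := FP_take_size (one1 _) hd; have hr := FP_drop_size (one1 _) hd.
  rewrite /PP2 /FP2 /sum_accepts /=.
  apply: PP_and; first by fp.
  apply: PP_and; first by fp.
  apply: PP_if; first by apply: PP_eq => //; apply: PP_const.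
    by fp.
  by fp.
- by apply: FP_dep_first => [|C hC]; [apply: FP_ones; fp|apply: FP_dep_first => // s hs; apply: hfirst => //; fp].
- by apply: FP_dep_last => [|C hC]; [apply: FP_ones; fp|apply: FP_dep_last => // s hs; apply: hlast => //; fp].
- rewrite /PP3 /FP3; apply: PP_dep_succ; try by fp.
  + by move=> C hC; apply: FP_dep_first => // s hs; apply: hfirst => //; fp.
  + by move=> C hC; apply: FP_dep_last => // s hs; apply: hlast => //; fp.
  + move=> C Y Z hC hY hZ; apply: PP_dep_succ => //.
    * by move=> s hs; apply: hfirst => //; fp.
    * by move=> s hs; apply: hlast => //; fp.
    * by move=> s y z hs hy hz; apply: hsucc => //; fp.
move=> x; rewrite !hornerD hornerC.
have [[c01 s01 D1E] rk1] := cfx x; have [[c02 s02 D2E] rk2] := cgx x.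
set N1 := (p1.[_])%R in rk1 *; set N2 := (p2.[_])%R in rk2 *.
set M1 := (m1.[_])%R in s01 D1E rk1 *; set M2 := (m2.[_])%R in s02 D2E rk2 *.
(* One rank function for each certificate is needed to form the product; for strings of another
   length it is arbitrary. *)
have /choice[h1 h1P] c : exists h, size c = M1 ->
    ranking N1 (F1 x c) (L1 x c) (S1 x c) h /\
    (D1 x c -> f x <= 2 ^ N1 /\ forall w, size w = N1 -> A1 x w = (2 ^ N1 <= h w + f x)).
  by have [/rk1[h ? ?]|ne] := eqVneq (size c) M1; [exists h|exists value => /eqP; rewrite (negbTE ne)].
have /choice[h2 h2P] c : exists h, size c = M2 ->
    ranking N2 (F2 x c) (L2 x c) (S2 x c) h /\
    (D2 x c -> g x <= 2 ^ N2 /\ forall w, size w = N2 -> A2 x w = (2 ^ N2 <= h w + g x)).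
  by have [/rk2[h ? ?]|ne] := eqVneq (size c) M2; [exists h|exists value => /eqP; rewrite (negbTE ne)].
change (M1 + M2)%R with (M1 + M2); change (N2 + N1)%R with (N2 + N1).
change (1 + (N2 + N1))%R with (1 + (N2 + N1)).
change (M1 + M2 + (1 + (N2 + N1)))%R with (M1 + M2 + (1 + (N2 + N1))).
pose rank_s (c s W : string) := if s == [:: false] then dep_rank N2 N1 (fun=> h1 (take M1 c)) W
  else dep_rank N1 N2 (fun _ w => (2 ^ N2).-1 - h2 (drop M1 c) w) W.
pose rank_c (c W : string) := dep_rank 1 (N2 + N1) (rank_s c) W.
have sizes (c : string) : size c = M1 + M2 -> size (take M1 c) = M1 /\ size (drop M1 c) = M2.
  by move=> sc; rewrite size_take_min size_drop sc; lia.
have rkc c : size c = M1 + M2 -> ranking (1 + (N2 + N1)) (dep_first 1 (sum_first x c))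
    (dep_last 1 (sum_last x c)) (dep_succ 1 (sum_first x c) (sum_last x c) (sum_succ x c)) (rank_c c).
  move=> /sizes[s1 s2]; apply: dep_ranking => s ss.
  rewrite /sum_first /sum_last /sum_succ /rank_s -/N1 -/N2 -/M1.
  case: ifP => _.
    by apply: dep_ranking => _ _; have [] := h1P _ s1.
  rewrite addnC; apply: dep_ranking => _ _; have [rk _] := h2P _ s2.
  exact: ranking_flip rk.
exists (dep_rank (M1 + M2) (1 + (N2 + N1)) rank_c).
  exact: dep_ranking.
have [r1 fin1] := h1P _ s01; have [r2 fin2] := h2P _ s02.
have [|fN1 A1E] := fin1; first by rewrite D1E ?eqxx.
have [|gN2 A2E] := fin2; first by rewrite D2E ?eqxx.
pose c0 := c01 ++ c02; have sc0 : size c0 = M1 + M2 by rewrite size_cat s01 s02.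
have NN : 2 ^ (N2 + N1) = 2 ^ N2 * 2 ^ N1 by rewrite expnD.
have [P1 P2] : 0 < 2 ^ N1 /\ 0 < 2 ^ N2 by rewrite !expn_gt0.
have fN : f x <= 2 ^ (N2 + N1) by rewrite NN; nia.
have gN : g x <= 2 ^ (N2 + N1) by rewrite NN; nia.
have BN : 2 ^ (1 + (N2 + N1)) = 2 ^ (N2 + N1) + 2 ^ (N2 + N1) by rewrite expnS; lia.
(* The interval starts [f x] words before the middle of the block of [c0] and extends [g x] words
   beyond it. *)
exists (value c0 * 2 ^ (1 + (N2 + N1)) + (2 ^ (N2 + N1) - f x)).
  have := value_lt c0; rewrite sc0 => lt.
  have : (value c0).+1 * 2 ^ (1 + (N2 + N1)) <= 2 ^ (M1 + M2) * 2 ^ (1 + (N2 + N1)).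
    by rewrite leq_mul2r lt orbT.
  by rewrite mulSn [2 ^ (M1 + M2 + _)]expnD; lia.
move=> W sW; set c := take (M1 + M2) W; set d := drop (M1 + M2) W.
have sc : size c = M1 + M2 by rewrite size_takel // sW leq_addr.
have sd : size d = 1 + (N2 + N1) by rewrite size_drop sW addKn.
have [sc1 sc2] := sizes _ sc; have [ltc _ _ _] := rkc _ sc.
rewrite /dep_rank -/c -/d block_interval ?ltc //; last by lia.
have -> : (value c == value c0) = (take M1 c == c01) && (drop M1 c == c02).
  rewrite -eqseq_cat ?sc1 // cat_take_drop -/c0.
  by apply/eqP/eqP => [|->//]; apply: value_inj; rewrite sc.
rewrite /sum_accepts hornerD -/M1 -/M2 -/N1 -/N2 -/c -/d D1E // D2E //.
rewrite -andbA; case: eqP => //= E1; case: eqP => //= E2.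
rewrite /rank_c /dep_rank /rank_s E1 E2.
case: d sd => [|s r] //= [sr]; rewrite take0 drop0 value_cons [value [::]]/= expn0 muln1 addn0.
case: s => /=.
  set a := take N1 r; set z := drop N1 r.
  have sa : size a = N1 by rewrite size_takel // sr leq_addl.
  have sz : size z = N2 by rewrite size_drop sr; lia.
  rewrite A2E // /dep_rank -/a -/z.
  have -> : (a == nseq N1 false) = (value a == 0).
    rewrite -(value_nseq0 N1); apply/eqP/eqP => [->//|].
    by apply: value_inj; rewrite size_nseq.
  have [lt _ _ _] := r2; have hz := lt _ sz.
  (* A final segment for [h2] is an initial one for the reversed rank. *)
  have -> : (2 ^ N2 <= h2 c02 z + g x) = ((2 ^ N2).-1 - h2 c02 z < g x) by lia.
  rewrite (@initial_segment (2 ^ N2)) //; last by lia.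
  by lia.
set a := take N2 r; set y := drop N2 r.
have sa : size a = N2 by rewrite size_takel // sr leq_addr.
have sy : size y = N1 by rewrite size_drop sr; lia.
rewrite A1E // /dep_rank -/a -/y.
have -> : (a == nseq N2 true) = (value a == (2 ^ N2).-1).
  rewrite -(value_nseq1 N2); apply/eqP/eqP => [->//|].
  by apply: value_inj; rewrite size_nseq.
have [lt _ _ _] := r1; have hy := lt _ sy.
have := value_lt a; rewrite sa => ha.
rewrite (@final_segment (2 ^ N1)) // -NN.
have : (value a).+1 * 2 ^ N1 <= 2 ^ (N2 + N1) by rewrite NN leq_mul2r ha orbT.
by rewrite mulSn; lia.
Qed.

End Sum.

(** In the reversed order the last path counted by [g] is its first one in the original order, so
    the certificate cuts just before that path. [sum_clustered] reverses again, which leaves the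
    paths counted by [g] as an initial segment. *)
Lemma sum_CLU f g : UP = coUP -> CLUsharpP f -> CLUsharpP g -> CLUsharpP (fun x => f x + g x).
Proof.
move=> UPcoUP /CLU_clustered[p1 [A1 [b1 [t1 [S1 cf]]]]] /CLU_clustered[p2 [A2 [b2 [t2 [S2 cg]]]]].
have [m1 [D1 [F1 [L1 [S1' cf']]]]] := clustered_certified cf UPcoUP.
have [m2 [D2 [F2 [L2 [S2' cg']]]]] := clustered_certified (clustered_flip cg) UPcoUP.
exact: clustered_CLU (sum_clustered cf' cg').
Qed.

Lemma UP_closed_coUP : (forall L : string -> Prop, UP L -> UP (fun x => ~ L x)) -> UP = coUP.
Proof.
move=> h; have notnot (L : language) : (fun x => ~ (fun x => ~ L x) x) = L.
  by apply: funext => x; apply: propext; split=> [|Lx nLx]; [exact: contrapT|exact: nLx].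
apply/seteqP; split=> [L /h nL|_ [L UL <-]]; last exact: h.
by exists (fun x => ~ L x) => //; apply: notnot.
Qed.

Lemma nat_FPt_UPSVt g : nat_FPt g -> nat_UPSVt g.
Proof. exact: FPt_UPSVt. Qed.

Lemma nat_FPt_one : nat_FPt (fun=> 1).
Proof.
apply: FP1_FPt; have -> : bin \o (fun=> 1) = fun=> [:: true] by [].
exact: FP_cons (FP_nil _).
Qed.

Theorem theorem4p2 :
  [<-> UP = coUP;
       forall f, CLUsharpP f -> CLUsharpP (fun x => f x + 1);
       forall f g, CLUsharpP f -> nat_FPt g -> CLUsharpP (fun x => f x + g x);
       forall f g, CLUsharpP f -> nat_UPSVt g -> CLUsharpP (fun x => f x + g x);
       forall f g, CLUsharpP f -> CLUsharpP g -> CLUsharpP (fun x => f x + g x)].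
Proof.
(* The constant 1 lies in all three classes of summands, so each closure property contains the
   increment and yields [UP = coUP]; from there [sum_CLU] gives the next statement. *)
have incr_coUP : (forall f, CLUsharpP f -> CLUsharpP (fun x => f x + 1)) -> UP = coUP.
  by move=> inc; apply: UP_closed_coUP => L; apply: increment_UP.
have one_UPSVt := nat_FPt_UPSVt nat_FPt_one.
tfae.
- by move=> eqUP f hf; apply: sum_CLU => //; apply: nat_UPSVt_CLU.
- move=> /incr_coUP eqUP f g hf hg; apply: sum_CLU => //.
  exact/nat_UPSVt_CLU/nat_FPt_UPSVt.
- move=> h f g hf hg; apply: sum_CLU => //; last exact: nat_UPSVt_CLU.
  by apply: incr_coUP => f' hf'; apply: h hf' nat_FPt_one.
- move=> h f g hf hg; apply: sum_CLU => //.
  by apply: incr_coUP => f' hf'; apply: h hf' one_UPSVt.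
- move=> h; apply: incr_coUP => f hf; apply: h => //; exact: nat_UPSVt_CLU.
Qed.
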